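(* Let $\Phi=(\varphi_n)_n$ be a frame for $\mathcal H$ with lower frame bound $m_\Phi$ and let $\Psi=(\psi_n)_n$ be a sequence in $\mathcal H$. Let $\mathcal A_1,\mathcal A_2\in B(\mathcal H)$ with $\|Id_{\mathcal H}-\mathcal A_i\|_{\rm op}<1$ ($i=1,2$), and let $\Lambda\in\mathrm{ran}_{B(\mathcal H,\ell^2)}(T_\Phi)$ be arbitrary. Let $M_{\widetilde\Phi(\Lambda)}$ be an upper frame bound of $\widetilde\Phi(\Lambda)$. Suppose that $\Phi$ and $\Psi$ are d-quadratically close (with respect to the dual $\widetilde\Phi(\Lambda)$) with ${\rm q}_\Lambda<1$. Then for each $\Theta\in\mathrm{ran}_{B(\mathcal H,\ell^2)}(T_\Phi)$, setting $\Theta_{ba}:=P_{\ker(T_\Psi)}U_{\Phi^{ad}_\Theta(\mathcal A_1)}$, the approximate dual $\Psi^{ad}_{\Theta_{ba}}(\mathcal A_2)$ of $\Psi$ is a best approximation of $\Phi^{ad}_\Theta(\mathcal A_1)$ in $\mathcal{AD}(\Psi)$ and a $\rho$-perturbation of $\Phi^{ad}_\Theta(\mathcal A_1)$, where $$\rho=\frac{\sqrt{{\rm q}\,M_{\widetilde\Phi(\Lambda)}}}{1-{\rm q}_\Lambda}\Big(\frac{\|\mathcal A_1\|_{\rm op}}{\sqrt{m_\Phi}}+\|\Theta\|_{\rm op}+\frac{\|\mathcal A_1-\mathcal A_2\|_{\rm op}}{\sqrt{{\rm q}}}\Big).$$ In particular: (1) if $\sqrt{m_\Phi M_{\widetilde\Phi(\Lambda)}}\le1-{\rm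 q}_\Lambda$, then $$\big\|\Phi^{ad}_0(\mathcal A_1)-\Psi^{ad}_0(\mathcal A_2)\big\|_{\mathfrak{Fr}}\le\frac{2\sqrt{{\rm q}}\,\|\mathcal A_1\|_{\rm op}+\sqrt{m_\Phi}\,\|\mathcal A_1-\mathcal A_2\|_{\rm op}}{m_\Phi};$$ (2) if $\sqrt{m_\Phi M_{\widetilde\Phi(\Lambda)}}>1-{\rm q}_\Lambda$, then $$\big\|\Phi^{ad}_0(\mathcal A_1)-\Psi^{ad}_0(\mathcal A_2)\big\|_{\mathfrak{Fr}}\le\frac{\sqrt{M_{\widetilde\Phi(\Lambda)}}}{1-{\rm q}_\Lambda}\left(2\|\mathcal A_1\|_{\rm op}\sqrt{\frac{{\rm q}}{m_\Phi}}+\|\mathcal A_1-\mathcal A_2\|_{\rm op}\right).$$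
   Context: $\mathcal H$ is a separable Hilbert space, $\ell^2=\ell^2(\mathbb N)$ with canonical orthonormal basis $(\delta_n)_n$. A sequence $\Phi=(\varphi_n)_{n\in\mathbb N}$ in $\mathcal H$ is a frame with (lower, upper) bounds $m_\Phi,M_\Phi>0$ if $m_\Phi\|f\|^2\le\sum_n|\langle f,\varphi_n\rangle|^2\le M_\Phi\|f\|^2$ for all $f\in\mathcal H$; it is a Bessel sequence if the right inequality holds. For a Bessel sequence $\Phi$: $U_\Phi f=(\langle f,\varphi_n\rangle)_n$ (analysis operator $\mathcal H\to\ell^2$), $T_\Phi=U_\Phi^*$ (synthesis operator), $S_\Phi=T_\Phi U_\Phi$ (frame operator), $\|\Phi\|_{\mathfrak{Fr}}:=\|T_\Phi\|_{\rm op}$. Differences of sequences are componentwise. A Bessel sequence $X$ is a $\rho$-perturbation of a Bessel sequence $Y$ if $\|T_X-T_Y\|_{\rm op}\le\rho$. For a frame $\Phi$, $\mathrm{ran}_{B(\mathcal H,\ell^2)}(T_\Phi):=\{\Theta\in B(\mathcal H,\ell^2):T_\Phi\Theta=0\}$. For $\Theta$ in this set and $\mathcal A\in B(\mathcal H)$ with $\|Id_{\mathcal H}-\mathcal A\|_{\rm op}<1$, $\Phi^{ad}_\Theta(\mathcal A):=\big(\mathcal A^*S_\Phi^{-1}\varphi_n+\Theta^*\delta_n\big)_n$, and $\widetilde\Phi(\Theta):=\Phi^{ad}_\Theta(Id_{\mathcal H})$, whose $n$-th component is written $\pi_n(\widetilde\Phi(\Theta))=S_\Phi^{-1}\varphi_n+\Theta^*\delta_n$.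 The $\widetilde\Phi(\Theta)$ are the dual frames of $\Phi$, and the $\Phi^{ad}_\Theta(\mathcal A)$ are exactly the approximately dual frames of $\Phi$ (Bessel sequences $\Phi^{ad}$ with $\|Id_{\mathcal H}-T_\Phi U_{\Phi^{ad}}\|_{\rm op}<1$), the set of which is denoted $\mathcal{AD}(\Phi)$. $P_X$ is the orthogonal projection of $\ell^2$ onto the closed subspace $X$. $\Phi$ and $\Psi$ are quadratically close if ${\rm q}:=\sum_n\|\varphi_n-\psi_n\|^2<\infty$. The frame $\Phi$ and the sequence $\Psi$ are d-quadratically close (with respect to $\widetilde\Phi(\Lambda)$) if they are quadratically close with $m_\Phi\le{\rm q}$ and ${\rm q}_\Lambda:=\sum_n\|\varphi_n-\psi_n\|\,\|\pi_n(\widetilde\Phi(\Lambda))\|<\infty$. (Under ${\rm q}_\Lambda<1$, $\Psi$ is a frame.) ''$\Psi^{ad}_{\Theta_{ba}}(\mathcal A_2)$ is a best approximation of $\Phi^{ad}_\Theta(\mathcal A_1)$ in $\mathcal{AD}(\Psi)$'' means: for all $\Lambda'\in\mathrm{ran}_{B(\mathcal H,\ell^2)}(T_\Psi)$, $\|\Psi^{ad}_{\Theta_{ba}}(\mathcal A_2)-\Phi^{ad}_\Theta(\mathcal A_1)\|_{\mathfrak{Fr}}\le\|\Psi^{ad}_{\Lambda'}(\mathcal A_2)-\Phi^{ad}_\Theta(\mathcal A_1)\|_{\mathfrak{Fr}}$. *)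

(* Defs.v *)
From HB Require Import structures.
From mathcomp Require Import all_boot all_order all_algebra.
From mathcomp Require Import sesquilinear.
From mathcomp Require Import all_classical all_reals all_analysis.
From mathcomp Require Import complex.
From mathcomp Require Import ring lra.

Set Implicit Arguments.
Unset Strict Implicit.
Unset Printing Implicit Defensive.

Import Order.TTheory GRing.Theory Num.Theory.
Import numFieldNormedType.Exports.

Local Open Scope classical_set_scope.
Local Open Scope ring_scope.

(* Hilbert spaces are over the reals or over the complex numbers. *)
Variant scalars := RealScalars | ComplexScalars.

Section scalar_defs.
Variable R : realType.

Definition scalar (F : scalars) : numFieldType :=
  match F with
  | RealScalars => R : numFieldType
  | ComplexScalars => R[i] : numFieldType
  end.

Definition re F : scalar F -> R :=
  match F return scalar F -> R with
  | RealScalars => fun x => x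
  | ComplexScalars => fun x => complex.Re x
  end.

Definition im F : scalar F -> R :=
  match F return scalar F -> R with
  | RealScalars => fun x => 0
  | ComplexScalars => fun x => complex.Im x
  end.

Definition of_re_im F : R -> R -> scalar F :=
  match F return R -> R -> scalar F with
  | RealScalars => fun a _ => a
  | ComplexScalars => fun a b => (a +i* b)%C
  end.

Definition conj F : scalar F -> scalar F :=
  match F return scalar F -> scalar F with
  | RealScalars => fun x => x
  | ComplexScalars => fun x => (x^*)%C
  end.

End scalar_defs.

(* MathComp's norm on a space over [scalar R F] takes its values in
   [scalar R F]; [nrm] is the same norm as an element of [R]. *)
Definition nrm (R : realType) (F : scalars) (V : normedZmodType (scalar R F))
  (x : V) : R := re `|x|.

Section scalar_theory.
Variables (R : realType) (F : scalars).
Local Notation K := (scalar R F).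
Implicit Types (x y : K) (a b : R).

Lemma reD x y : re (x + y) = re x + re y.
Proof. by case: F x y => // -[? ?] [? ?]. Qed.

Lemma imD x y : im (x + y) = im x + im y.
Proof. by case: F x y => [? ?|[? ?] [? ?]] //=; rewrite addr0. Qed.

Lemma reN x : re (- x) = - re x.
Proof. by case: F x => // -[? ?]. Qed.

Lemma imN x : im (- x) = - im x.
Proof. by case: F x => [?|[? ?]] //=; rewrite oppr0. Qed.

Lemma reB x y : re (x - y) = re x - re y.
Proof. by rewrite reD reN. Qed.

Lemma imB x y : im (x - y) = im x - im y.
Proof. by rewrite imD imN. Qed.

Lemma re0 : re (0 : K) = 0. Proof. by case: F. Qed.

Lemma im0 : im (0 : K) = 0. Proof. by case: F. Qed.

Lemma re_conj x : re (conj x) = re x.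
Proof. by case: F x => // -[? ?]. Qed.

Lemma im_conj x : im (conj x) = - im x.
Proof. by case: F x => [?|[? ?]] //=; rewrite oppr0. Qed.

Lemma re_of a b : re (of_re_im F a b) = a.
Proof. by case: F. Qed.

Lemma im_of a : im (of_re_im F a 0) = 0.
Proof. by case: F. Qed.

Lemma scalar_ext x y : re x = re y -> im x = im y -> x = y.
Proof. by case: F x y => [//|[? ?] [? ?]] /= -> ->. Qed.

Lemma conjK : involutive (@conj R F).
Proof. by move=> x; apply: scalar_ext; rewrite ?re_conj ?im_conj ?opprK. Qed.

Lemma conj_is_zmod_morphism : zmod_morphism (@conj R F).
Proof.
move=> x y; apply: scalar_ext.
  by rewrite re_conj !reB !re_conj.
by rewrite im_conj !imB !im_conj opprB opprK addrC.
Qed.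

Lemma conj_is_monoid_morphism : monoid_morphism (@conj R F).
Proof. by case: F => //; split; [exact: conjc1 | exact: rmorphM]. Qed.

HB.instance Definition _ := GRing.isZmodMorphism.Build K K (@conj R F)
  conj_is_zmod_morphism.
HB.instance Definition _ := GRing.isMonoidMorphism.Build K K (@conj R F)
  conj_is_monoid_morphism.

Lemma of_reD a b : of_re_im F (a + b) 0 = of_re_im F a 0 + of_re_im F b 0.
Proof.
by case: F => //=; apply/eqP; rewrite eq_complex /= addr0 !eqxx.
Qed.

Lemma of_reM a b : of_re_im F (a * b) 0 = of_re_im F a 0 * of_re_im F b 0.
Proof.
by case: F => //=; apply/eqP; rewrite eq_complex /= !(mulr0, mul0r) addr0 subr0 !eqxx.
Qed.

Lemma re_ofM a x : re (of_re_im F a 0 * x) = a * re x.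
Proof. by case: F x => //= -[? ?] /=; rewrite mul0r subr0. Qed.

Lemma le_of_re a b : (of_re_im F a 0 <= of_re_im F b 0) = (a <= b).
Proof. by case: F => //=; rewrite lecE /= eqxx. Qed.

Lemma lt_of_re a b : (of_re_im F a 0 < of_re_im F b 0) = (a < b).
Proof. by case: F => //=; rewrite ltcE /= eqxx. Qed.

Lemma of_re0 : of_re_im F 0 0 = 0 :> K. Proof. by case: F. Qed.

Lemma ge0_of_re x : 0 <= x -> x = of_re_im F (re x) 0.
Proof.
case: F x => [//|[a b]] /=; rewrite lecE /= => /andP[/eqP-> _] //.
Qed.

Lemma nrmE (V : normedZmodType K) (v : V) : `|v| = of_re_im F (nrm v) 0.
Proof. exact: ge0_of_re. Qed.

Lemma nrm_ge0 (V : normedZmodType K) (v : V) : 0 <= nrm v.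
Proof. by rewrite -le_of_re -nrmE of_re0. Qed.

Lemma nrm0 (V : normedZmodType K) : nrm (0 : V) = 0.
Proof. by rewrite /nrm normr0 re0. Qed.

Lemma ler_nrmD (V : normedZmodType K) (v w : V) : nrm (v + w) <= nrm v + nrm w.
Proof. by rewrite -le_of_re of_reD -!nrmE ler_normD. Qed.

Lemma nrmN (V : normedZmodType K) (v : V) : nrm (- v) = nrm v.
Proof. by rewrite /nrm normrN. Qed.

Lemma nrm_distC (V : normedZmodType K) (v w : V) : nrm (v - w) = nrm (w - v).
Proof. by rewrite /nrm distrC. Qed.

Lemma nrmM x y : nrm (x * y) = nrm x * nrm y.
Proof. by rewrite {1}/nrm normrM nrmE re_ofM. Qed.

Lemma nrm_sqr x : nrm x ^+ 2 = re x ^+ 2 + im x ^+ 2.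
Proof.
rewrite /nrm; case: F x => [x|[a b]] /=.
  by rewrite expr0n addr0 real_normK// num_real.
by rewrite sqr_sqrtr// addr_ge0 ?sqr_ge0.
Qed.

Lemma nrm_conj x : nrm (conj x) = nrm x.
Proof.
apply/eqP; rewrite -(@eqrXn2 _ 2) ?nrm_ge0//.
by rewrite !nrm_sqr re_conj im_conj sqrrN.
Qed.

Lemma mul_conj x : x * conj x = of_re_im F (nrm x ^+ 2) 0.
Proof.
rewrite nrm_sqr; case: F x => [x|[a b]] /=; first by rewrite expr0n addr0.
by apply/eqP; rewrite eq_complex/= mulrN opprK -!expr2 mulrN mulrC addNr !eqxx.
Qed.

Lemma re_le_nrm x : `|re x| <= nrm x.
Proof.
rewrite -(@ler_pXn2r _ 2) ?nnegrE ?nrm_ge0// nrm_sqr real_normK ?num_real//.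
by rewrite lerDl sqr_ge0.
Qed.

Lemma im_le_nrm x : `|im x| <= nrm x.
Proof.
rewrite -(@ler_pXn2r _ 2) ?nnegrE ?nrm_ge0// nrm_sqr real_normK ?num_real//.
by rewrite lerDr sqr_ge0.
Qed.

Lemma nrm_le_reim x : nrm x <= `|re x| + `|im x|.
Proof.
rewrite -(@ler_pXn2r _ 2) ?nnegrE ?nrm_ge0 ?addr_ge0// nrm_sqr sqrrD.
rewrite !real_normK ?num_real// addrAC lerDl mulrn_wge0 ?mulr_ge0//.
Qed.

Lemma cvg_nrmP (V : normedModType K) (G : set_system V) (FG : Filter G) (l : V) :
  G --> l <-> forall e : R, 0 < e -> \forall v \near G, nrm (l - v) < e.
Proof.
split=> [/fcvgrPdist_lt H e e0|H].
  have := H (of_re_im F e 0); rewrite -of_re0 lt_of_re => /(_ e0).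
  by apply: filterS => v; rewrite nrmE lt_of_re.
apply/fcvgrPdist_lt => e e0.
have e'0 : 0 < re e by rewrite -lt_of_re -ge0_of_re ?ltW// of_re0.
have := H _ e'0; apply: filterS => v.
by rewrite nrmE [X in _ -> _ < X]ge0_of_re ?ltW// lt_of_re.
Qed.

Lemma cauchy_nrm (V : normedModType K) (G : set_system V) (FG : Filter G) :
  cauchy G -> forall e : R, 0 < e -> \forall v & w \near G, nrm (v - w) < e.
Proof.
move=> /cauchy_ballP H e e0.
have := H (of_re_im F e 0); rewrite -of_re0 lt_of_re => /(_ e0).
by apply: filterS => -[v w] /=; rewrite -ball_normE /= nrmE lt_of_re.
Qed.

Lemma cvg_reim T (G : set_system T) (FG : Filter G) (f : T -> K) a b :
  re (f t) @[t --> G] --> a -> im (f t) @[t --> G] --> b -> f @ G --> of_re_im F a b.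
Proof.
move=> fa fb; apply/cvg_nrmP => e e0.
have e20 : 0 < e / 2 by rewrite divr_gt0.
move/cvgrPdist_lt : fb => /(_ _ e20); move/cvgrPdist_lt : fa => /(_ _ e20).
apply: filterS2 => t /= H1 H2.
have [ea eb] : re (of_re_im F a b - f t) = a - re (f t) /\
  `|im (of_re_im F a b - f t)| <= `|b - im (f t)|.
  rewrite reB imB re_of; split => //.
  by case: F (f t) => [x|//] /=; rewrite subrr normr0.
rewrite (le_lt_trans (nrm_le_reim _))// ea.
by rewrite [X in _ < X](splitr e) ltrD// (le_lt_trans eb).
Qed.

End scalar_theory.

HB.mixin Record CompleteNormedModule_isHilbert (R : realType) (F : scalars) H
    & CompleteNormedModule (scalar R F) H := {
  ip : {dot H for @conj R F};
  ip_norm : forall x : H, ip x x = `|x| ^+ 2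
}.

#[short(type="hilbertType")]
HB.structure Definition Hilbert (R : realType) (F : scalars) :=
  {H of CompleteNormedModule (scalar R F) H
      & CompleteNormedModule_isHilbert R F H}.

Definition square_summable (R : realType) (F : scalars) (x : nat -> scalar R F) :=
  (\sum_(0 <= n <oo) (nrm (x n) ^+ 2)%:E < +oo)%E.

Section square_summable_theory.
Variables (R : realType) (F : scalars).
Local Notation K := (scalar R F).
Implicit Types x y : nat -> K.

Lemma square_summableP x : square_summable x <->
  exists M : R, forall n, \sum_(0 <= i < n) nrm (x i) ^+ 2 <= M.
Proof.
have ge0 n : (0 <= n)%N -> true -> (0 <= (nrm (x n) ^+ 2)%:E)%E.
  by rewrite lee_fin sqr_ge0.
rewrite /square_summable; split=> [H|[M H]].
  have fs : (\sum_(0 <= n <oo) (nrm (x n) ^+ 2)%:E)%E \is a fin_num.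
    by rewrite ge0_fin_numE// nneseries_ge0.
  exists (fine (\sum_(0 <= n <oo) (nrm (x n) ^+ 2)%:E)%E) => n.
  rewrite -lee_fin fineK// -sumEFin.
  by apply: nneseries_lim_ge => i _; exact: ge0.
apply: (@le_lt_trans _ _ M%:E); last exact: ltry.
apply: lime_le; first exact: is_cvg_nneseries.
by apply: nearW => n; rewrite sumEFin lee_fin.
Qed.

Lemma square_summable_submod : submod_closed
  [pred x : nat -> K | `[< square_summable x >]].
Proof.
split.
  rewrite -topredE /=; apply/asboolP; apply/square_summableP; exists 0 => n.
  by rewrite big1// => i _; rewrite nrm0 expr0n.
move=> a x y; rewrite -!topredE /= => /asboolP/square_summableP[M HM].
move=> /asboolP/square_summableP[N HN].
apply/asboolP; apply/square_summableP; exists (2 * nrm a ^+ 2 * M + 2 * N) => n.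
apply: (@le_trans _ _ (\sum_(0 <= i < n)
    (2 * nrm a ^+ 2 * nrm (x i) ^+ 2 + 2 * nrm (y i) ^+ 2))).
  apply: ler_sum => i _.
  have : nrm ((a *: x + y) i) <= nrm a * nrm (x i) + nrm (y i).
    by rewrite -nrmM; exact: ler_nrmD.
  move=> le1; have := lerXn2r 2 _ _ le1.
  rewrite !nnegrE ?nrm_ge0 ?addr_ge0 ?mulr_ge0 ?nrm_ge0// => /(_ isT isT).
  move=> /le_trans; apply.
  rewrite -mulrA -exprMn; set u := nrm a * _; set v := nrm (y i).
  rewrite -subr_ge0.
  suff -> : 2 * u ^+ 2 + 2 * v ^+ 2 - (u + v) ^+ 2 = (u - v) ^+ 2.
    exact: sqr_ge0.
  rewrite sqrrD sqrrB !mulr_natl !mulr2n; ring.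
rewrite big_split /= -!mulr_sumr.
by apply: lerD; apply: ler_wpM2l; rewrite // mulr_ge0 ?sqr_ge0.
Qed.

End square_summable_theory.

Record ell2 (R : realType) (F : scalars) := Ell2 {
  ell2_seq :> nat -> scalar R F;
  _ : ell2_seq \in [pred x : nat -> scalar R F | `[< square_summable x >]]
}.

HB.instance Definition _ R F := [isSub for @ell2_seq R F].
HB.instance Definition _ R F := [Choice of ell2 R F by <:].
HB.instance Definition _ R F := GRing.isSubmodClosed.Build (scalar R F)
  (nat -> scalar R F) [pred x : nat -> scalar R F | `[< square_summable x >]]
  (@square_summable_submod R F).
HB.instance Definition _ R F :=
  [SubChoice_isSubLmodule of ell2 R F by <:].

Section ell2_ip.
Variables (R : realType) (F : scalars).
Local Notation K := (scalar R F).
Implicit Types x y z : ell2 R F.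

Lemma ell2_bounded x : exists M : R, forall n, \sum_(0 <= i < n) nrm (x i) ^+ 2 <= M.
Proof.
by case: x => x xP /=; apply/square_summableP; move: xP; rewrite -topredE => /asboolP.
Qed.

Lemma cvg_nrm_sqr x : cvgn (series (fun n => nrm (x n) ^+ 2)).
Proof.
have [M HM] := ell2_bounded x.
apply: nondecreasing_is_cvgn.
  by apply: nondecreasing_series => n _ _; exact: sqr_ge0.
by exists M => _ [n _ <-]; exact: HM.
Qed.

Definition ell2_ip x y : K := limn (series (fun n => x n * conj (y n))).

Lemma re_series (u : nat -> K) n : re (series u n) = series (fun n => re (u n)) n.
Proof.
by rewrite /series /=; elim/big_rec2 : _ => [|i a b _ <-]; rewrite ?re0 ?reD.
Qed.

Lemma im_series (u : nat -> K) n : im (series u n) = series (fun n => im (u n)) n.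
Proof.
by rewrite /series /=; elim/big_rec2 : _ => [|i a b _ <-]; rewrite ?im0 ?imD.
Qed.

Lemma ell2_ip_cvg x y :
  series (fun n => x n * conj (y n)) @ \oo --> ell2_ip x y.
Proof.
have cxy : cvgn (series (fun n => nrm (x n * conj (y n)))).
  apply: (@series_le_cvg _ _
      ((fun n => nrm (x n) ^+ 2) + (fun n => nrm (y n) ^+ 2))).
  - by move=> n; exact: nrm_ge0.
  - by move=> n; rewrite addr_ge0 ?sqr_ge0.
  - move=> n; rewrite nrmM nrm_conj.
    have := sqr_ge0 (nrm (x n) - nrm (y n)).
    have := mulr_ge0 (nrm_ge0 (x n)) (nrm_ge0 (y n)).
    rewrite sqrrB /=; set a := nrm (x n); set b := nrm (y n).
    rewrite -[_ (fun n => nrm (x n) ^+ 2) _ n]/(a ^+ 2 + b ^+ 2); nra.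
  - by apply: is_cvg_seriesD; exact: cvg_nrm_sqr.
have cf (f : K -> R) : (forall z : K, `|f z| <= nrm z) ->
    cvgn (series (fun n => f (x n * conj (y n)))).
  move=> fle; apply: normed_cvg; apply: series_le_cvg cxy => n //=.
  exact: nrm_ge0.
have cre := cf _ (@re_le_nrm R F); have cim := cf _ (@im_le_nrm R F).
suff : series (fun n => x n * conj (y n)) @ \oo -->
  of_re_im F (limn (series (fun n => re (x n * conj (y n)))))
             (limn (series (fun n => im (x n * conj (y n))))).
  by move=> H; apply: cvgP H.
apply: cvg_reim.
  by under eq_fun do rewrite re_series.
by under eq_fun do rewrite im_series.
Qed.

Lemma ell2_ipE x y (l : K) :
  series (fun n => x n * conj (y n)) @ \oo --> l -> ell2_ip x y = l.
Proof. by move=> H; apply: cvg_lim. Qed.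

Lemma ell2_ip_linearl y a x z :
  ell2_ip (a *: x + z) y = a * ell2_ip x y + ell2_ip z y.
Proof.
apply: ell2_ipE.
have -> : (fun n => (a *: x + z) n * conj (y n)) =
   a *: (fun n => x n * conj (y n)) + (fun n => z n * conj (y n)).
  by apply/funext => n; rewrite mulrDl -mulrA.
rewrite seriesD seriesZ; apply: cvgD; last exact: ell2_ip_cvg.
by apply: cvgZl_tmp; exact: ell2_ip_cvg.
Qed.

Lemma ell2_ip_conj x y : ell2_ip x y = conj (ell2_ip y x).
Proof.
apply: ell2_ipE.
have -> : series (fun n => x n * conj (y n)) =
    fun n => conj (series (fun n => y n * conj (x n)) n).
  apply/funext => n; rewrite /series /= rmorph_sum; apply: eq_bigr => i _.
  by rewrite rmorphM /= conjK mulrC.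
apply/cvg_nrmP => e e0.
have /cvg_nrmP/(_ e e0) := @ell2_ip_cvg y x; rewrite !near_map.
by apply: filterS => n; rewrite -rmorphB nrm_conj.
Qed.

Lemma ell2_ipxx x :
  ell2_ip x x = of_re_im F (limn (series (fun n => nrm (x n) ^+ 2))) 0.
Proof.
apply: ell2_ipE; apply: cvg_reim.
  under eq_fun do rewrite re_series.
  have -> : (fun n => re (x n * conj (x n))) = (fun n => nrm (x n) ^+ 2).
    by apply/funext => n; rewrite mul_conj re_of.
  exact: cvg_nrm_sqr.
under eq_fun do rewrite im_series.
apply: cvg_near_cst; apply: nearW => n; rewrite /series /= big1// => i _.
by rewrite mul_conj im_of.
Qed.

Lemma ell2_ip_linearr x a y z :
  ell2_ip x (a *: y + z) = conj a * ell2_ip x y + ell2_ip x z.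
Proof.
by rewrite ell2_ip_conj ell2_ip_linearl rmorphD rmorphM /= -!ell2_ip_conj.
Qed.

Lemma le_ell2_sum x n :
  \sum_(0 <= i < n) nrm (x i) ^+ 2 <= re (ell2_ip x x).
Proof.
rewrite ell2_ipxx re_of.
apply: (@nondecreasing_cvgn_le _ (series (fun n => nrm (x n) ^+ 2))).
  by apply: nondecreasing_series => i _ _; exact: sqr_ge0.
exact: cvg_nrm_sqr.
Qed.

Lemma ell2_ip_gt0 x : x != 0 -> 0 < ell2_ip x x.
Proof.
move=> x0; have [n xn0] : exists n, x n != 0.
  apply: contrapT => /forallNP H; move/eqP : x0; apply.
  apply: val_inj; apply/funext => n /=.
  by apply/eqP; apply: contrapT => /negP; exact: H.
rewrite ell2_ipxx -of_re0 lt_of_re.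
have := le_ell2_sum x n.+1; rewrite ell2_ipxx re_of; apply: lt_le_trans.
rewrite big_nat_recr//= ltr_wpDl ?sumr_ge0//.
  by move=> i _; exact: sqr_ge0.
rewrite exprn_gt0// lt_neqAle nrm_ge0 andbT eq_sym.
apply: contra xn0 => /eqP h; rewrite -normr_eq0 nrmE h.
by rewrite of_re0.
Qed.

HB.instance Definition _ := @bilinear_isBilinear.Build K (ell2 R F) (ell2 R F)
  K *%R (@conj R F \; *%R) ell2_ip
  (fun y => ell2_ip_linearl y, ell2_ip_linearr).
Lemma ell2_ip_hermitian x y : ell2_ip x y = (-1) ^+ false * conj (ell2_ip y x).
Proof. by rewrite expr0 mul1r -ell2_ip_conj. Qed.
HB.instance Definition _ := @isHermitianSesquilinear.Build K (ell2 R F) false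
  (@conj R F) ell2_ip ell2_ip_hermitian.
HB.instance Definition _ := @isDotProduct.Build K (ell2 R F) ell2_ip ell2_ip_gt0.

End ell2_ip.

Section ell2_norm.
Variables (R : realType) (F : scalars).
Local Notation K := (scalar R F).
Local Notation rr a := (of_re_im F a 0).
Implicit Types x y z : ell2 R F.

Let N x : R := Num.sqrt (re (ell2_ip x x)).

Let N_sqr x : N x ^+ 2 = re (ell2_ip x x).
Proof.
rewrite sqr_sqrtr//; have := le_ell2_sum x 0; by rewrite big_geq.
Qed.

Let N_ge0 x : 0 <= N x. Proof. exact: sqrtr_ge0. Qed.

Let ipxx x : ell2_ip x x = rr (N x ^+ 2).
Proof. by rewrite N_sqr ell2_ipxx re_of. Qed.

Let conj_rr (a : R) : conj (rr a) = rr a.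
Proof. by apply: scalar_ext; rewrite ?re_conj ?im_conj ?im_of ?oppr0. Qed.

Let quad x y (t : R) : re (ell2_ip (rr t *: y + x) (rr t *: y + x)) =
  t ^+ 2 * N y ^+ 2 + 2 * t * re (ell2_ip x y) + N x ^+ 2.
Proof.
rewrite ell2_ip_linearl !ell2_ip_linearr !conj_rr mulrDr !reD !re_ofM.
rewrite [ell2_ip y x]ell2_ip_conj re_conj -!N_sqr; ring.
Qed.

Let quad_ge0 x y (t : R) :
  0 <= t ^+ 2 * N y ^+ 2 + 2 * t * re (ell2_ip x y) + N x ^+ 2.
Proof. by rewrite -quad -N_sqr sqr_ge0. Qed.

Let ip0 y : ell2_ip 0 y = 0.
Proof.
apply: ell2_ipE; apply: cvg_near_cst; apply: nearW => n.
by rewrite /series /= big1// => i _; rewrite mul0r.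
Qed.

Let CS x y : re (ell2_ip x y) <= N x * N y.
Proof.
have [y0|y0] := eqVneq (N y) 0.
  have [->|yn0] := eqVneq y 0.
    by rewrite ell2_ip_conj ip0 rmorph0 re0 mulr_ge0.
  have := ell2_ip_gt0 yn0.
  by rewrite ipxx -of_re0 lt_of_re y0 expr0n ltxx.
have Ny : 0 < N y by rewrite lt_neqAle eq_sym y0 N_ge0.
have := quad_ge0 x y (- (N x / N y)).
have -> : (- (N x / N y)) ^+ 2 * N y ^+ 2 = N x ^+ 2 by field.
set b := re _ => h.
have {}h : 0 <= 2 * (N x / N y) * (N x * N y - b).
  have -> : 2 * (N x / N y) * (N x * N y - b) =
    N x ^+ 2 + 2 * - (N x / N y) * b + N x ^+ 2 by field.
  exact: h.
have [x0|x0] := eqVneq (N x) 0; last first.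
  have Nx : 0 < N x by rewrite lt_neqAle eq_sym x0 N_ge0.
  by move: h; rewrite pmulr_rge0 ?subr_ge0// mulr_gt0 ?divr_gt0.
have H t : 0 <= t ^+ 2 * N y ^+ 2 + 2 * t * b.
  by have := quad_ge0 x y t; rewrite x0 expr0n addr0.
rewrite x0 mul0r leNgt; apply/negP => b0.
have := H (- (b / N y ^+ 2)).
have -> : (- (b / N y ^+ 2)) ^+ 2 * N y ^+ 2 + 2 * - (b / N y ^+ 2) * b =
  - (b ^+ 2 / N y ^+ 2) by field.
by rewrite oppr_ge0 leNgt divr_gt0// exprn_gt0.
Qed.

Let ler_ND x y : N (x + y) <= N x + N y.
Proof.
rewrite -(@ler_pXn2r _ 2) ?nnegrE ?addr_ge0// N_sqr.
have := quad y x 1; have -> : rr 1 = 1 by case: F.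
rewrite scale1r => ->; have := CS y x; nra.
Qed.

Let NZ (a : K) x : N (a *: x) = nrm a * N x.
Proof.
apply/eqP; rewrite -(@eqrXn2 _ 2) ?mulr_ge0 ?nrm_ge0// exprMn !N_sqr.
rewrite -[a *: x]addr0 ell2_ip_linearl ell2_ip_linearr.
by rewrite ip0 [ell2_ip x 0]ell2_ip_conj ip0 rmorph0 !addr0 mulrA mul_conj re_ofM.
Qed.

Definition ell2_norm x : K := rr (N x).

Lemma ell2_ler_normD x y : ell2_norm (x + y) <= ell2_norm x + ell2_norm y.
Proof. by rewrite -of_reD le_of_re. Qed.

Lemma ell2_normrZ (a : K) x : ell2_norm (a *: x) = `|a| * ell2_norm x.
Proof. by rewrite nrmE -of_reM -NZ. Qed.

Lemma ell2_normr0_eq0 x : ell2_norm x = 0 -> x = 0.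
Proof.
move=> x0; apply/eqP; apply: contrapT => /negP /ell2_ip_gt0.
rewrite ipxx -of_re0 lt_of_re.
by rewrite -[N x](re_of F _ 0) [of_re_im _ _ _]x0 re0 expr0n ltxx.
Qed.

HB.instance Definition _ := @Lmodule_isNormed.Build K (ell2 R F)
  ell2_norm ell2_ler_normD ell2_normrZ ell2_normr0_eq0.

Lemma ell2_ip_norm x : ell2_ip x x = `|x| ^+ 2.
Proof.
by rewrite ipxx [RHS]expr2 -[`|x|]/(ell2_norm x) -of_reM.
Qed.

Lemma ell2_nrm_sqr x : nrm x ^+ 2 = limn (series (fun n => nrm (x n) ^+ 2)).
Proof.
by rewrite /nrm -[`|x|]/(ell2_norm x) re_of N_sqr ell2_ipxx re_of.
Qed.

Lemma ell2_nrm_le x (M : R) : 0 <= M ->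
  (forall n, \sum_(0 <= i < n) nrm (x i) ^+ 2 <= M ^+ 2) -> nrm x <= M.
Proof.
move=> M0 HM; rewrite -(@ler_pXn2r _ 2) ?nnegrE ?nrm_ge0// ell2_nrm_sqr.
by apply: limr_le; [exact: cvg_nrm_sqr | exact: nearW].
Qed.

Lemma ell2_sum_le x n : \sum_(0 <= i < n) nrm (x i) ^+ 2 <= nrm x ^+ 2.
Proof.
by rewrite ell2_nrm_sqr; have := le_ell2_sum x n; rewrite ell2_ipxx re_of.
Qed.

Lemma ell2_coord_le x n : nrm (x n) <= nrm x.
Proof.
rewrite -(@ler_pXn2r _ 2) ?nnegrE ?nrm_ge0//.
apply: le_trans (ell2_sum_le x n.+1); rewrite big_nat_recr//= lerDr.
by apply: sumr_ge0 => i _; exact: sqr_ge0.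
Qed.

Lemma cvg_nrm T (G : set_system T) (FG : Filter G) (f : T -> K) (l : K) :
  f @ G --> l -> nrm (f t) @[t --> G] --> nrm l.
Proof.
move=> /cvg_nrmP H; apply/cvgrPdist_lt => e e0.
move: (H _ e0); rewrite near_map; apply: filterS => t; apply: le_lt_trans.
have := ler_nrmD (l - f t) (f t); rewrite subrK.
have := ler_nrmD (f t - l) l; rewrite subrK nrm_distC.
by rewrite ler_norml; lra.
Qed.

Lemma ell2_complete (G : set_system (ell2 R F)) :
  ProperFilter G -> cauchy G -> cvg G.
Proof.
move=> PG CG.
have ball0 (e : R) : 0 < e -> exists x0, G [set y | nrm (x0 - y) < e].
  move=> e0; have /cauchyP/(_ (rr e)) := CG.
  rewrite -of_re0 lt_of_re => /(_ e0) [x0 Gx0]; exists x0.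
  by move: Gx0; apply: filterS => y; rewrite -ball_normE /= nrmE lt_of_re.
have coord (f : K -> R) n : (forall u v : K, f (u - v) = f u - f v) ->
    (forall z : K, `|f z| <= nrm z) -> cvg (f (y n) @[y --> G]).
  move=> fB fle; apply: R_complete; apply/cauchyP => e e0.
  have [x0 Gx0] := ball0 e e0; exists (f (x0 n)).
  apply: (@filterS _ G _ _ _ _ Gx0) => y /=; rewrite -ball_normE /=.
  by apply: le_lt_trans; rewrite -fB (le_trans (fle _))// -[x0 n - y n]/((x0 - y) n) ell2_coord_le.
pose l n : K := of_re_im F (lim (re (y n) @[y --> G])) (lim (im (y n) @[y --> G])).
have lP n : ((y : ell2 R F) n : K) @[y --> G] --> l n.
  apply: cvg_reim.
    exact: (coord _ n (@reB R F) (@re_le_nrm R F)).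
  exact: (coord _ n (@imB R F) (@im_le_nrm R F)).
have key (e : R) x0 : 0 < e -> G [set y | nrm (x0 - y) < e] ->
    forall n, \sum_(0 <= i < n) nrm (x0 i - l i) ^+ 2 <= e ^+ 2.
  move=> e0 Gx0 n.
  have H : (\sum_(0 <= i < n) nrm (x0 i - (y : ell2 R F) i) ^+ 2) @[y --> G] -->
      \sum_(0 <= i < n) nrm (x0 i - l i) ^+ 2.
    elim: n => [|n IHn].
      under eq_fun do rewrite big_geq//.
      by rewrite big_geq//; exact: cvg_cst.
    under eq_fun do rewrite big_nat_recr//=.
    rewrite big_nat_recr//=; apply: cvgD => //.
    under eq_fun do rewrite expr2.
    have cn : nrm (x0 n - (y : ell2 R F) n) @[y --> G] --> nrm (x0 n - l n).
      by apply: cvg_nrm; apply: cvgB => //; exact: cvg_cst.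
    by rewrite expr2; exact: cvgM.
  rewrite -(cvg_lim _ H)//; apply: limr_le; first by apply: cvgP H.
  move: Gx0; apply: filterS => y /= xy.
  apply: (le_trans (ell2_sum_le (x0 - y) n)).
  by rewrite ler_pXn2r ?nnegrE ?nrm_ge0 ?ltW.
have [x0 Gx0] := ball0 1 ltr01.
have dP : (fun n => x0 n - l n) \in
    [pred x : nat -> K | `[< square_summable x >]].
  rewrite -topredE /=; apply/asboolP; apply/square_summableP.
  by exists (1 ^+ 2); exact: key.
pose L : ell2 R F := x0 - Ell2 dP.
have LE n : L n = l n by rewrite -[L n]/(x0 n - (x0 n - l n)) subKr.
apply: (cvgP L); apply/cvg_nrmP => e e0.
have e20 : 0 < e / 2 by rewrite divr_gt0.
have [x1 Gx1] := ball0 _ e20.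
have := Gx1; apply: filterS => y /= x1y.
have -> : L - y = (L - x1) + (x1 - y) by rewrite addrA subrK.
rewrite (le_lt_trans (ler_nrmD _ _))// [X in _ < X](splitr e) ler_ltD//.
rewrite nrm_distC; apply: ell2_nrm_le; first exact: ltW.
move=> n; have := key _ _ e20 Gx1 n.
by under eq_bigr do rewrite -LE.
Qed.

HB.instance Definition _ := Uniform_isComplete.Build (ell2 R F) ell2_complete.
HB.instance Definition _ := CompleteNormedModule_isHilbert.Build R F (ell2 R F)
  ell2_ip_norm.

End ell2_norm.

Section ell2_basis.
Variables (R : realType) (F : scalars).

Lemma delta_subproof n : (fun k => (k == n)%:R) \in
  [pred x : nat -> scalar R F | `[< square_summable x >]].
Proof.
rewrite -topredE /=; apply/asboolP; apply/square_summableP; exists 1 => N.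
have E : forall i, nrm ((i == n)%:R : scalar R F) ^+ 2 = (i == n)%:R.
  move=> i; case: eqP => _; last by rewrite nrm0 expr0n.
  by rewrite nrm_sqr; case: F => /=; rewrite expr1n expr0n addr0.
under eq_bigr do rewrite E.
rewrite -natr_sum (_ : 1 = 1%N%:R)// ler_nat.
have [nN|Nn] := ltnP n N.
  rewrite (bigD1_seq n) ?iota_uniq ?mem_index_iota//= eqxx big1 ?addn0//.
  by move=> i /negbTE ->.
rewrite big_nat big1// => i /andP[_ iN].
by rewrite (ltn_eqF (leq_trans iN Nn)).
Qed.

Definition delta n : ell2 R F := Ell2 (delta_subproof n).

End ell2_basis.

Section operators.
Variables (R : realType) (F : scalars) (U V : hilbertType R F).

Definition bounded_op (A : U -> V) : Prop := linear A /\ continuous A.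

Definition opnorm (A : U -> V) : R :=
  sup [set nrm (A x) | x in [set x | nrm x <= 1]].

(* By the Riesz theorem such an [x] exists, and is unique, for all [y] when [A]
   is a bounded operator. *)
Definition adjoint (A : U -> V) (y : V) : U :=
  xget 0 [set x | forall u, ip (A u) y = ip u x].

(* This is a two-sided inverse when [A] is bijective. *)
Definition op_inv (A : U -> V) (y : V) : U := xget 0 [set x | A x = y].

Definition op_ker (A : U -> V) : set U := [set x | A x = 0].

(* Orthogonal projection onto [X]; such a [p] exists, and is unique, for all [x]
   when [X] is a closed subspace. *)
Definition orthoproj (X : set U) (x : U) : U :=
  xget 0 [set p | X p /\ forall z, X z -> ip (x - p) z = 0].

End operators.

Section frames.
Variables (R : realType) (F : scalars) (H : hilbertType R F).
Implicit Types (X Y : nat -> H) (A : H -> H) (Theta : H -> ell2 R F).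

Definition coef_sqr_sum X (f : H) : \bar R :=
  (\sum_(0 <= n <oo) (nrm (ip f (X n)) ^+ 2)%:E)%E.

Definition lower_frame_bound X (m : R) : Prop :=
  0 < m /\ forall f : H, ((m * nrm f ^+ 2)%:E <= coef_sqr_sum X f)%E.

Definition upper_frame_bound X (M : R) : Prop :=
  0 < M /\ forall f : H, (coef_sqr_sum X f <= (M * nrm f ^+ 2)%:E)%E.

Definition is_bessel X : Prop := exists M, upper_frame_bound X M.

Definition is_frame X : Prop :=
  exists m M, lower_frame_bound X m /\ upper_frame_bound X M.

(* [insubd 0 x] is the sequence [x] as an element of l^2, whenever [x] is
   square-summable, which is the case below as soon as [X] is Bessel. *)
Definition analysis X (f : H) : ell2 R F := insubd 0 (fun n => ip f (X n)).

Definition synthesis X : ell2 R F -> H := adjoint (analysis X).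

Definition frame_op X : H -> H := synthesis X \o analysis X.

Definition fr_norm X : R := opnorm (synthesis X).

Definition perturbation (rho : R) X Y : Prop :=
  [/\ is_bessel X, is_bessel Y & opnorm (synthesis X \- synthesis Y) <= rho].

Definition ran_syn X : set (H -> ell2 R F) :=
  [set Theta | bounded_op Theta /\ forall f, synthesis X (Theta f) = 0].

(* For an operator [A] with ||Id - A|| < 1 and [Theta] in [ran_syn X], this is the
   approximately dual frame X^ad_Theta(A). *)
Definition ad X Theta A : nat -> H := fun n =>
  adjoint A (op_inv (frame_op X) (X n)) + adjoint Theta (delta R F n).

Definition dual_frame X Theta : nat -> H := ad X Theta idfun.

Definition AD X : set (nat -> H) :=
  [set Y | is_bessel Y /\ opnorm (idfun \- (synthesis X \o analysis Y)) < 1].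

(* [ad X Theta A] is a best approximation of [Y] in [AD X]: the competitors share
   the operator [A]. *)
Definition best_approximation X A Theta Y : Prop :=
  forall Theta', ran_syn X Theta' ->
    fr_norm (ad X Theta A \- Y) <= fr_norm (ad X Theta' A \- Y).

Definition qdist X Y : \bar R :=
  (\sum_(0 <= n <oo) (nrm (X n - Y n) ^+ 2)%:E)%E.

Definition dqdist X Y Theta : \bar R :=
  (\sum_(0 <= n <oo) (nrm (X n - Y n) * nrm (dual_frame X Theta n))%:E)%E.

Definition quadratically_close X Y : Prop := (qdist X Y < +oo)%E.

(* [m] is the lower frame bound of the frame [X]. *)
Definition d_quadratically_close X (m : R) Y Theta : Prop :=
  [/\ quadratically_close X Y, (m%:E <= qdist X Y)%E
    & (dqdist X Y Theta < +oo)%E].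

End frames.

(* Main.v *)
Require Import Defs.
From HB Require Import structures.
From mathcomp Require Import all_boot all_order all_algebra.
From mathcomp Require Import sesquilinear.
From mathcomp Require Import all_classical all_reals all_analysis.
From mathcomp Require Import ring lra.

Set Implicit Arguments.
Unset Strict Implicit.
Unset Printing Implicit Defensive.

Import Order.TTheory GRing.Theory Num.Theory.
Import numFieldNormedType.Exports.

Local Open Scope classical_set_scope.
Local Open Scope ring_scope.

(** Write [U], [T], [S] for the analysis, synthesis and frame operators of a
    frame, and let [L = U S^-1], a right inverse of [T].  Three facts about [L]
    carry the proof: [T L = id]; the range of [L] is orthogonal to [ker T], so
    that [P = id - L T] is the orthogonal projection onto [ker T]; and
    [|L g| <= |g| / c] as soon as [c |f| <= |U f|] for all [f].  The analysis
    operator of the approximate dual given by [Theta] and [A] is [L A + Theta]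
    ([analysis_ad]).

    Best approximation.  For a Bessel sequence [Z] with analysis operator [V],
    the analysis operator of [Psi^ad_Theta(A) - Z] is
    [L (A - T V) + (Theta - P V)] ([analysis_adB]).  The two summands are
    pointwise orthogonal and only the second one depends on [Theta], so
    [Theta = P V] minimises the norm at every vector ([ba_best]).

    Lower bound for [Psi].  The dual frame [D] of [Phi] given by
    [Lambda] reconstructs:
    [<U_Phi f, U_D f> = |f|^2].  Replacing [Phi] by [Psi] changes the left-hand
    side by at most [qL |f|^2], whence
    [(1 - qL) / sqrt M |f| <= |U_Psi f|] ([lower_of_dual_close]).

    Distances.  With [V = L_Phi A1 + Theta] one has [T_Phi V = A1], so the
    difference to the best approximation is
    [L_Psi (A2 - A1 + (T_Phi - T_Psi) V)]; since [|T_Phi - T_Psi| <= sqrt q],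
    this gives [rho] ([ba_fr_norm]).  For the canonical approximate duals, split
    [L_Phi - L_Psi] along the range of [U_Psi] and [ker T_Psi]:
    [L_Phi - L_Psi = L_Psi (T_Psi - T_Phi) L_Phi
    + P_Psi (U_Phi - U_Psi) S_Phi^-1] ([pinv_syn_dist]).  The two cases of the
    theorem compare the bounds [1 / sqrt m] and [sqrt M / (1 - qL)] of [L_Phi]
    and [L_Psi].

    The adjoints and the inverse of [S] come from one variational argument
    ([energy_minimizer]): if [W] is bounded and bounded below and [f] is a
    bounded functional, the minimiser [x] of [|W x|^2 - 2 Re f(x)] satisfies
    [<W u, W x> = f u] for all [u].  For [W = id] this is the Riesz
    representation; for [W = U] it is the surjectivity of [S]. *)

(** * Inner products and real-valued norms *)

Section hilbert_basics.
Variables (R : realType) (F : scalars) (H : hilbertType R F).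
Local Notation K := (Defs.scalar R F).
Local Notation rr a := (of_re_im F a 0).
Implicit Types x y z : H.

Lemma nrm_rr (a : R) : nrm (rr a : K) = `|a|.
Proof.
apply/eqP; rewrite -(@eqrXn2 _ 2) ?nrm_ge0// nrm_sqr re_of im_of.
by rewrite real_normK ?num_real// expr0n addr0.
Qed.

Lemma nrmZ (V : normedModType K) (a : K) (v : V) : nrm (a *: v) = nrm a * nrm v.
Proof. by rewrite {1}/nrm normrZ nrmE re_ofM. Qed.

Lemma nrm_eq0 (V : normedZmodType K) (v : V) : nrm v = 0 -> v = 0.
Proof. by move=> v0; apply/eqP; rewrite -normr_eq0 nrmE v0 of_re0. Qed.

Lemma ipDl x y z : ip (x + y) z = ip x z + ip y z.
Proof. exact: linearDl. Qed.
Lemma ipBl x y z : ip (x - y) z = ip x z - ip y z.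
Proof. exact: linearBl. Qed.
Lemma ipDr x y z : ip x (y + z) = ip x y + ip x z.
Proof. exact: linearDr. Qed.
Lemma ipBr x y z : ip x (y - z) = ip x y - ip x z.
Proof. exact: linearBr. Qed.
Lemma ip0l x : ip 0 x = 0.
Proof. exact: linear0l. Qed.
Lemma ip0r x : ip x 0 = 0.
Proof. exact: linear0r. Qed.
Lemma ipZl (a : K) x y : ip (a *: x) y = a * ip x y.
Proof. exact: linearZl_LR. Qed.
Lemma ipZr (a : K) x y : ip x (a *: y) = conj a * ip x y.
Proof. exact: linearZr_LR. Qed.
Lemma ip_conj x y : ip x y = conj (ip y x).
Proof. by have := hermC ip x y; rewrite expr0 mul1r. Qed.
Lemma ipxx x : ip x x = rr (nrm x ^+ 2).
Proof. by rewrite ip_norm nrmE expr2 -of_reM. Qed.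

End hilbert_basics.

Section hilbert_norm.
Variables (R : realType) (F : scalars) (H : hilbertType R F).
Local Notation rr a := (of_re_im F a 0).
Implicit Types x y z : H.

Lemma re_ipC x y : re (ip x y) = re (ip y x).
Proof. by rewrite ip_conj re_conj. Qed.

Lemma re_ipxx x : re (ip x x) = nrm x ^+ 2.
Proof. by rewrite ipxx re_of. Qed.

Lemma nrmD_sqr x y : nrm (x + y) ^+ 2 = nrm x ^+ 2 + 2 * re (ip x y) + nrm y ^+ 2.
Proof.
rewrite -!re_ipxx ipDl !ipDr !reD [re (ip y x)]re_ipC; ring.
Qed.

Lemma nrmB_sqr x y : nrm (x - y) ^+ 2 = nrm x ^+ 2 - 2 * re (ip x y) + nrm y ^+ 2.
Proof.
rewrite -!re_ipxx ipBl !ipBr !reB [re (ip y x)]re_ipC; ring.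
Qed.

Lemma re_ipZl (a : R) x y : re (ip (rr a *: x) y) = a * re (ip x y).
Proof. by rewrite ipZl re_ofM. Qed.

Lemma re_ipZr (a : R) x y : re (ip x (rr a *: y)) = a * re (ip x y).
Proof. by rewrite re_ipC re_ipZl re_ipC. Qed.

Lemma re_ip_le x y : re (ip x y) <= nrm x * nrm y.
Proof.
have [x0|x0] := eqVneq (nrm x) 0.
  by rewrite x0 mul0r (nrm_eq0 x0) ip0l re0.
have [y0|y0] := eqVneq (nrm y) 0.
  by rewrite y0 mulr0 (nrm_eq0 y0) ip0r re0.
have a0 : 0 < nrm x by rewrite lt_neqAle eq_sym x0 nrm_ge0.
have b0 : 0 < nrm y by rewrite lt_neqAle eq_sym y0 nrm_ge0.
have := sqr_ge0 (nrm (rr (nrm y) *: x - rr (nrm x) *: y)).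
rewrite nrmB_sqr re_ipZl re_ipZr !nrmZ !nrm_rr !ger0_norm ?nrm_ge0//.
move: (nrm x) (nrm y) (re _) a0 b0 {x0 y0} => a b r a0 b0 h.
have : 0 <= 2 * (a * b) * (a * b - r) by nra.
by rewrite pmulr_rge0 ?mulr_gt0// subr_ge0.
Qed.

(** The Cauchy-Schwarz inequality. *)
Lemma nrm_ip_le x y : nrm (ip x y) <= nrm x * nrm y.
Proof.
have [->|z0] := eqVneq (nrm (ip x y)) 0; first by rewrite mulr_ge0 ?nrm_ge0.
have zp : 0 < nrm (ip x y) by rewrite lt_neqAle eq_sym z0 nrm_ge0.
(* |z|^2 = Re <x, z y> for z = <x, y>, which reduces to real parts. *)
rewrite -(ler_pM2l zp) -expr2.
have -> : nrm (ip x y) ^+ 2 = re (ip x (ip x y *: y)).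
  by rewrite ipZr mulrC mul_conj re_of.
by rewrite (le_trans (re_ip_le _ _))// nrmZ mulrCA.
Qed.

Lemma ip_inj x y : (forall z, ip z x = ip z y) -> x = y.
Proof.
move=> h; apply/eqP; rewrite -subr_eq0; apply/eqP/nrm_eq0/eqP.
by rewrite -[_ == 0](@expf_eq0 _ _ 2) -re_ipxx ipBr h subrr re0.
Qed.

(** Completeness of [H] for Cauchy sequences, with real-valued norms. *)
Lemma hilbert_cauchy (x : nat -> H) :
  (forall e : R, 0 < e -> exists N, forall m n, (N <= m)%N -> (N <= n)%N ->
    nrm (x m - x n) < e) ->
  exists l : H, forall e : R, 0 < e -> exists N, forall n, (N <= n)%N ->
    nrm (l - x n) < e.
Proof.
move=> xc; have /cvg_ex[l /cvg_nrmP xl] : cvg (x @ \oo).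
  apply: cauchy_cvg; apply/cauchyP => e e0.
  have e'0 : 0 < re e by rewrite -(@lt_of_re R F) -ge0_of_re ?ltW// of_re0.
  have [N xN] := xc _ e'0; exists (x N); exists N => // n /= Nn.
  rewrite -ball_normE /= nrmE [X in _ < X]ge0_of_re ?ltW// lt_of_re.
  exact: xN.
exists l => e /xl [N _ xN]; exists N => n Nn; exact: xN.
Qed.

End hilbert_norm.

(** * Bounded linear maps *)

Section linear_maps.
Variables (R : realType) (F : scalars).
Local Notation rr a := (of_re_im F a 0).

Lemma linear_funE (U V : hilbertType R F) (A : U -> V) : linear A ->
  forall a x y, A (a *: x + y) = a *: A x + A y.
Proof. by move=> lA a x y; exact: lA. Qed.

Lemma linear_fun0 (U V : hilbertType R F) (A : U -> V) : linear A -> A 0 = 0.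
Proof.
by move=> /linear_funE/(_ (-1) 0 0); rewrite scaler0 addr0 scaleN1r addNr.
Qed.

Lemma linear_funD (U V : hilbertType R F) (A : U -> V) x y :
  linear A -> A (x + y) = A x + A y.
Proof. by move=> /linear_funE/(_ 1 x y); rewrite !scale1r. Qed.

Lemma linear_funZ (U V : hilbertType R F) (A : U -> V) a x :
  linear A -> A (a *: x) = a *: A x.
Proof. by move=> lA; have := linear_funE lA a x 0; rewrite (linear_fun0 lA) !addr0. Qed.

Lemma linear_funB (U V : hilbertType R F) (A : U -> V) x y :
  linear A -> A (x - y) = A x - A y.
Proof. by move=> lA; rewrite -scaleN1r linear_funD// linear_funZ// scaleN1r. Qed.

Variables (U V : hilbertType R F).
Implicit Types A : U -> V.

(** [C] is a bound for [A]: an upper bound of the operator norm when [0 <= C]. *)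
Definition bounded_by A (C : R) := forall x, nrm (A x) <= C * nrm x.

Lemma bounded_by_op A C : linear A -> bounded_by A C -> bounded_op A.
Proof.
move=> lA bA; split => // x; apply/cvg_nrmP => e e0.
have C0 : 0 < `|C| + 1 by rewrite ltr_wpDl.
have [d d0 de] : exists2 d, 0 < d & (`|C| + 1) * d = e.
  by exists (e / (`|C| + 1)); rewrite ?divr_gt0// mulrC divfK ?gt_eqF.
have /cvg_nrmP/(_ d d0) : y @[y --> x] --> x by exact: cvg_id.
rewrite !near_map; apply: filterS => y xy /=; rewrite -(linear_funB _ _ lA).
apply: (le_lt_trans (bA _)).
rewrite -de; apply: (@le_lt_trans _ _ ((`|C| + 1) * nrm (x - y))).
  by rewrite ler_wpM2r ?nrm_ge0// (le_trans (ler_norm C))// lerDl.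
by rewrite ltr_pM2l.
Qed.

Lemma bounded_op_by A : bounded_op A -> exists2 C, 0 <= C & bounded_by A C.
Proof.
move=> [lA cA]; have /cvg_nrmP/(_ 1 ltr01) := cA 0.
rewrite near_map => /nbhs_ballP[e /= e0 eA].
have e'0 : 0 < re e by rewrite -(@lt_of_re R F) -ge0_of_re ?ltW// of_re0.
have eA' x : nrm x < re e -> nrm (A x) <= 1.
  move=> xe; have /= := eA x; rewrite linear_fun0// sub0r nrmN => h.
  apply/ltW/h; rewrite -ball_normE /= sub0r normrN nrmE.
  by rewrite [X in _ < X]ge0_of_re ?ltW// lt_of_re.
exists (2 / re e); first by rewrite divr_ge0// ltW.
move=> x; have [x0|x0] := eqVneq (nrm x) 0.
  by rewrite (nrm_eq0 x0) linear_fun0// !nrm0 mulr0.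
have xp : 0 < nrm x by rewrite lt_neqAle eq_sym x0 nrm_ge0.
(* Rescaling x to norm e / 2 puts it strictly inside the ball of radius e. *)
have tp : 0 < re e / (2 * nrm x) by rewrite divr_gt0 ?mulr_gt0.
have := eA' (rr (re e / (2 * nrm x)) *: x).
rewrite linear_funZ// !nrmZ nrm_rr gtr0_norm//.
have -> : re e / (2 * nrm x) * nrm x = re e / 2 by field.
have -> : (re e / 2 < re e) by lra.
move=> /(_ isT); rewrite -ler_pdivlMl// => /le_trans; apply.
by rewrite mulr1 invf_div mulrAC.
Qed.

Lemma opnorm_has_sup A : bounded_op A ->
  has_sup [set nrm (A x) | x in [set x | nrm x <= 1]].
Proof.
move=> /bounded_op_by[C C0 bA]; split.
  by exists (nrm (A 0)), 0 => //=; rewrite nrm0.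
exists C => _ [x /= x1 <-]; apply: (le_trans (bA x)).
by rewrite ler_piMr.
Qed.

Lemma nrm_opnorm A : bounded_op A -> bounded_by A (opnorm A).
Proof.
move=> bA x; have [x0|x0] := eqVneq (nrm x) 0.
  by rewrite (nrm_eq0 x0) linear_fun0 ?nrm0 ?mulr0//; case: bA.
have xp : 0 < nrm x by rewrite lt_neqAle eq_sym x0 nrm_ge0.
rewrite -ler_pdivrMr//; apply: ub_le_sup; first by case: (opnorm_has_sup bA).
exists (rr (nrm x)^-1 *: x) => /=.
  by rewrite nrmZ nrm_rr ger0_norm ?invr_ge0 ?nrm_ge0// mulVf.
rewrite linear_funZ; last by case: bA.
by rewrite nrmZ nrm_rr ger0_norm ?invr_ge0 ?nrm_ge0// mulrC.
Qed.

Lemma opnorm_le A C : 0 <= C -> bounded_by A C -> opnorm A <= C.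
Proof.
move=> C0 bA; apply: sup_le_ub.
  by exists (nrm (A 0)), 0 => //=; rewrite nrm0.
move=> _ [x /= x1 <-]; apply: (le_trans (bA x)).
by rewrite ler_piMr.
Qed.

Lemma opnorm_ge0 A : bounded_op A -> 0 <= opnorm A.
Proof.
move=> bA; apply: (@le_trans _ _ (nrm (A 0))); first exact: nrm_ge0.
apply: ub_le_sup; first by case: (opnorm_has_sup bA).
by exists 0 => //=; rewrite nrm0.
Qed.

End linear_maps.

(** * Minimisation of quadratic energies, adjoints *)

Section energy.
Variables (R : realType) (F : scalars) (H V : hilbertType R F).
Local Notation K := (Defs.scalar R F).
Local Notation rr a := (of_re_im F a 0).
Variables (U : H -> V) (c C B : R) (f : H -> K).
Hypothesis linU : linear U.
Hypotheses (c0 : 0 < c) (C0 : 0 <= C) (B0 : 0 <= B).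
Hypothesis lowU : forall x, c * nrm x <= nrm (U x).
Hypothesis uppU : bounded_by U C.
Hypothesis linf : forall a x y, f (a *: x + y) = a * f x + f y.
Hypothesis bndf : forall x, nrm (f x) <= B * nrm x.

Let energy x := nrm (U x) ^+ 2 - 2 * re (f x).

Let fD x y : f (x + y) = f x + f y.
Proof. by have := linf 1 x y; rewrite scale1r mul1r. Qed.

Let f0 : f 0 = 0.
Proof.
have := fD 0 0; rewrite addr0 => /esym/eqP.
by rewrite -subr_eq0 addrK => /eqP.
Qed.

Let fZ a x : f (a *: x) = a * f x.
Proof. by have := linf a x 0; rewrite !addr0 f0 addr0. Qed.

Let energyD x h : energy (x + h) =
  energy x + 2 * (re (ip (U x) (U h)) - re (f h)) + nrm (U h) ^+ 2.
Proof. rewrite /energy fD (linear_funD _ _ linU) nrmD_sqr reD; ring. Qed.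

Let re_f_le x : `|re (f x)| <= B * nrm x.
Proof. exact: le_trans (re_le_nrm _) (bndf x). Qed.

Let sq_lowU x : c ^+ 2 * nrm x ^+ 2 <= nrm (U x) ^+ 2.
Proof.
rewrite -exprMn; apply: lerXn2r; rewrite ?nnegrE ?nrm_ge0//.
by rewrite mulr_ge0 ?nrm_ge0 ?ltW.
Qed.

Let energy_lb x : - (B / c) ^+ 2 <= energy x.
Proof.
have h1 := sq_lowU x; have := re_f_le x; rewrite ler_norml => /andP[_ h2].
apply: (@le_trans _ _ (c ^+ 2 * nrm x ^+ 2 - 2 * (B * nrm x))); last first.
  by rewrite /energy; lra.
have := sqr_ge0 (c * nrm x - B / c).
have -> : (c * nrm x - B / c) ^+ 2 =
    c ^+ 2 * nrm x ^+ 2 - 2 * (B * nrm x) + (B / c) ^+ 2.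
  by field; rewrite gt_eqF.
lra.
Qed.

Let E := [set energy x | x in [set: H]].

Let E_has_inf : has_inf E.
Proof.
split; first by exists (energy 0), 0.
by exists (- (B / c) ^+ 2) => _ [x _ <-]; exact: energy_lb.
Qed.

Let inf_le x : inf E <= energy x.
Proof. by apply: ge_inf; [case: E_has_inf | exists x]. Qed.

Let near_min (e : R) : 0 < e -> exists x, energy x < inf E + e.
Proof. by move=> e0; have [_ [x _ <-] h] := inf_adherent e0 E_has_inf; exists x. Qed.

(* By the parallelogram law around the midpoint of x and y, approximate
   minimisers are close to each other. *)
Let near_min_close x y a b : energy x < inf E + a -> energy y < inf E + b ->
  c ^+ 2 * nrm (x - y) ^+ 2 <= 2 * (a + b).
Proof.
move=> xa yb.
pose h := rr (2^-1) *: (x - y); pose z := y + h.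
have zx : z + h = x.
  rewrite /z -addrA -scalerDl -of_reD.
  have -> : (2^-1 + 2^-1 : R) = 1 by lra.
  have -> : rr 1 = 1 :> K by case: (F).
  by rewrite scale1r addrC subrK.
have zy : z - h = y by rewrite /z addrK.
have := energyD z h; have := energyD z (- h); rewrite zx zy => ey ex.
have iz := inf_le z.
have Uh : nrm (U (- h)) ^+ 2 = nrm (U h) ^+ 2.
  by rewrite -sub0r (linear_funB _ _ linU) (linear_fun0 linU) sub0r nrmN.
have fh : re (f (- h)) = - re (f h).
  by rewrite -scaleN1r fZ mulN1r reN.
have iph : re (ip (U z) (U (- h))) = - re (ip (U z) (U h)).
  by rewrite -[- h]sub0r (linear_funB _ _ linU) (linear_fun0 linU) ipBr ip0r sub0r reN.
rewrite Uh fh iph in ey.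
have := sq_lowU h; rewrite {1}/h nrmZ nrm_rr ger0_norm ?invr_ge0// exprMn.
have -> : (2^-1 ^+ 2 : R) = 4^-1 by field.
lra.
Qed.

Let quad0 (a b : R) : (forall t, 0 <= 2 * t * b + t ^+ 2 * a) -> b = 0.
Proof.
move=> h; apply/eqP; rewrite -[_ == 0](@expf_eq0 _ _ 2) eq_le sqr_ge0 andbT.
have A0 : 0 < `|a| + 1 by rewrite ltr_wpDl.
(* Minimising 2 t b + t^2 (|a| + 1) over t gives t = - b / (|a| + 1). *)
have := h (- b / (`|a| + 1)).
have -> : 2 * (- b / (`|a| + 1)) * b + (- b / (`|a| + 1)) ^+ 2 * a =
   (b ^+ 2) * (a - 2 * (`|a| + 1)) / (`|a| + 1) ^+ 2.
  by field; rewrite gt_eqF.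
rewrite pmulr_lge0 ?invr_gt0 ?exprn_gt0// => h1.
have h2 : a - 2 * (`|a| + 1) <= - 1 by have := ler_norm a; have := normr_ge0 a; lra.
have := sqr_ge0 b; nra.
Qed.

(** The approximate minimisers of [|U x|^2 - 2 Re f(x)] converge to a minimiser,
    and [<U u, U x> = f u] is the Euler equation there. *)
Lemma energy_minimizer : exists x, forall u, ip (U u) (U x) = f u.
Proof.
have en n : exists x, energy x < inf E + n.+1%:R^-1.
  by apply: near_min; rewrite invr_gt0.
have [xs xsE] := choice en.
have small (e : R) : 0 < e -> exists N, forall n, (N <= n)%N -> n.+1%:R^-1 < e.
  move=> e0; exists (Num.truncn e^-1) => n Nn.
  rewrite invf_plt ?posrE// (lt_le_trans (truncnS_gt _))// ler_nat ltnS.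
  exact: Nn.
have [l xl] : exists l : H, forall e : R, 0 < e -> exists N, forall n, (N <= n)%N ->
    nrm (l - xs n) < e.
  apply: hilbert_cauchy => e e0.
  have [|N NE] := small (c ^+ 2 * e ^+ 2 / 4).
    by rewrite divr_gt0// mulr_gt0// exprn_gt0.
  exists N => m n Nm Nn.
  have h := near_min_close (xsE m) (xsE n).
  have := NE _ Nm; have := NE _ Nn => h1 h2.
  have : c ^+ 2 * nrm (xs m - xs n) ^+ 2 < c ^+ 2 * e ^+ 2.
    rewrite (le_lt_trans h)//.
    have -> : c ^+ 2 * e ^+ 2 = 2 * (c ^+ 2 * e ^+ 2 / 4 + c ^+ 2 * e ^+ 2 / 4) by field.
    by rewrite ltr_pM2l// ltrD.
  by rewrite ltr_pM2l ?exprn_gt0// ltr_pXn2r ?nnegrE ?nrm_ge0// ltW.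
have l_min : energy l <= inf E.
  apply/ler_addgt0Pr => e e0.
  (* D |xs n - l| bounds the linear part of energy (xs n) - energy l; the
     summand 1 makes D positive. *)
  pose D := 2 * (C * nrm l * C + B) + 1.
  have D0 : 0 < D.
    by rewrite ltr_wpDl// mulr_ge0// addr_ge0// !mulr_ge0 ?nrm_ge0.
  have [|N1 h1] := small (e / 2); first by rewrite divr_gt0.
  have [|N2 h2] := xl (e / 2 / D); first by rewrite !divr_gt0.
  pose n := maxn N1 N2; have {}h1 := h1 n (leq_maxl _ _).
  have := h2 n (leq_maxr _ _); rewrite ltr_pdivlMr// nrm_distC => {}h2.
  have := energyD l (xs n - l); rewrite addrC subrK => e1.
  have e2 : energy (xs n) < inf E + e / 2 by rewrite (lt_trans (xsE n))// ltrD2l.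
  have e3 := sqr_ge0 (nrm (U (xs n - l))).
  have := re_f_le (xs n - l); rewrite ler_norml => /andP[_ e4].
  have e5 : - re (ip (U l) (U (xs n - l))) <= C * nrm l * C * nrm (xs n - l).
    have := le_trans (re_le_nrm _) (nrm_ip_le (U l) (U (xs n - l))).
    rewrite ler_norml => /andP[+ _]; rewrite lerNl => /le_trans; apply.
    by rewrite -mulrA ler_pM ?nrm_ge0//; exact: uppU.
  move: h2; rewrite /D.
  have := nrm_ge0 (xs n - l); lra.
exists l.
have key u : re (ip (U u) (U l)) = re (f u).
  apply/eqP; rewrite -subr_eq0; apply/eqP.
  apply: (@quad0 (nrm (U u) ^+ 2)) => t.
  have := inf_le (l + rr t *: u); rewrite energyD fZ (linear_funZ _ _ linU).
  rewrite re_ipC re_ipZl re_ofM nrmZ nrm_rr exprMn real_normK ?num_real//.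
  lra.
(* Imaginary parts follow from real parts, replacing u by -i u; over the reals
   both vanish. *)
have imE (z : K) : im z = re (of_re_im F 0 (-1) * z).
  by case: F z => [z|[a b]] /=; rewrite mul0r// sub0r mulN1r opprK.
move=> u; apply: scalar_ext; first exact: key.
by rewrite !imE -fZ -ipZl -(linear_funZ _ _ linU) key.
Qed.

End energy.

Section adjoints.
Variables (R : realType) (F : scalars) (U V : hilbertType R F) (A : U -> V).
Hypothesis bopA : bounded_op A.

(** The Riesz representation theorem makes [adjoint A] an actual adjoint. *)
Lemma adjointP u y : ip (A u) y = ip u (adjoint A y).
Proof.
have [linA _] := bopA; have [C C0 bA] := bounded_op_by bopA.
have [x xP] : exists x, forall u, ip u x = ip (A u) y.
  apply: (@energy_minimizer _ _ U U id 1 1 (C * nrm y)) => //.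
  - by rewrite mulr_ge0 ?nrm_ge0.
  - by move=> z; rewrite mul1r.
  - by move=> z; rewrite mul1r.
  - by move=> a v w; rewrite (linear_funE linA) ipDl ipZl.
  - move=> z; rewrite (le_trans (nrm_ip_le _ _))// mulrAC.
    by rewrite ler_wpM2r ?nrm_ge0.
rewrite /adjoint; case: xgetP => [z _ zP|/(_ x)]; first exact: zP.
by case => v; rewrite xP.
Qed.

Lemma adjoint_unique y x : (forall u, ip (A u) y = ip u x) -> adjoint A y = x.
Proof. by move=> h; apply: ip_inj => u; rewrite -adjointP h. Qed.

Lemma adjoint_linear : linear (adjoint A).
Proof.
move=> a x y; apply: adjoint_unique => u.
by rewrite !ipDr !ipZr -!adjointP.
Qed.

Lemma adjoint_bounded C : 0 <= C -> bounded_by A C -> bounded_by (adjoint A) C.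
Proof.
move=> C0 bA y; have [->|y0] := eqVneq (nrm (adjoint A y)) 0.
  by rewrite mulr_ge0 ?nrm_ge0.
have yp : 0 < nrm (adjoint A y) by rewrite lt_neqAle eq_sym y0 nrm_ge0.
rewrite -(ler_pM2l yp) -expr2 -re_ipxx -adjointP.
rewrite (le_trans (re_ip_le _ _))// mulrA [_ * C]mulrC.
by rewrite ler_wpM2r ?nrm_ge0.
Qed.

Lemma adjoint_bounded_op : bounded_op (adjoint A).
Proof.
have [C C0 bA] := bounded_op_by bopA.
by apply: (bounded_by_op adjoint_linear); apply: adjoint_bounded bA.
Qed.

End adjoints.

(** * Bessel sequences and their analysis operators *)

Section bessel.
Variables (R : realType) (F : scalars) (H : hilbertType R F).
Implicit Types (X Y : nat -> H) (W : H -> ell2 R F).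

Lemma ell2_nneseries (x : ell2 R F) :
  (\sum_(0 <= n <oo) (nrm (x n) ^+ 2)%:E)%E = (nrm x ^+ 2)%:E.
Proof.
rewrite ell2_nrm_sqr -EFin_lim; last exact: cvg_nrm_sqr.
by congr (limn _); apply/funext => n /=; rewrite sumEFin.
Qed.

(** The [n]-th coordinate of [x] is its inner product with [delta n]. *)
Lemma ip_delta (x : ell2 R F) n : ip x (delta R F n) = x n.
Proof.
apply: ell2_ipE; apply: cvg_near_cst; exists n.+1 => // k /= nk.
rewrite /series /= (bigD1_seq n) ?iota_uniq ?mem_index_iota//= eqxx rmorph1 mulr1.
by rewrite big1 ?addr0// => i /negbTE ->; rewrite rmorph0 mulr0.
Qed.

Lemma analysis_eq X W : (forall f n, W f n = ip f (X n)) -> analysis X = W.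
Proof.
move=> h; apply/funext => f; rewrite /analysis.
have -> : (fun n => ip f (X n)) = \val (W f) by apply/funext => n; rewrite -h.
exact: valKd.
Qed.

Lemma coef_sqr_sumE X W f : (forall f n, W f n = ip f (X n)) ->
  coef_sqr_sum X f = (nrm (W f) ^+ 2)%:E.
Proof.
move=> h; rewrite -ell2_nneseries; apply: eq_eseriesr => n _.
by rewrite -h.
Qed.

Lemma bessel_of_bounded X W C : (forall f n, W f n = ip f (X n)) ->
  bounded_by W C -> is_bessel X.
Proof.
(* The summand 1 keeps the upper bound positive when C = 0. *)
move=> h bW; exists (C ^+ 2 + 1); split; first by rewrite ltr_wpDl ?sqr_ge0.
move=> f; rewrite (coef_sqr_sumE _ h) lee_fin.
apply: (@le_trans _ _ (C ^+ 2 * nrm f ^+ 2)); last first.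
  by rewrite ler_wpM2r ?sqr_ge0// lerDl.
rewrite -exprMn; apply: lerXn2r; rewrite ?nnegrE ?nrm_ge0//.
exact: le_trans (nrm_ge0 _) (bW f).
Qed.

Lemma analysis_coef X f n : is_bessel X -> analysis X f n = ip f (X n).
Proof.
move=> [M [_ /(_ f) XM]]; rewrite /analysis -[LHS]/(\val _ n) insubdK//.
rewrite -topredE /=; apply/asboolP; exact: le_lt_trans XM (ltry _).
Qed.

Lemma nrm_analysis X f : is_bessel X ->
  coef_sqr_sum X f = (nrm (analysis X f) ^+ 2)%:E.
Proof. by move=> bX; apply: coef_sqr_sumE => g n; exact: analysis_coef. Qed.

Lemma ell2P (x y : ell2 R F) : (forall n, x n = y n) -> x = y.
Proof. by move=> h; apply: val_inj; apply/funext. Qed.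

Lemma analysis_linear X : is_bessel X -> linear (analysis X).
Proof.
move=> bX a x y; apply: ell2P => n.
rewrite -[RHS]/(a * analysis X x n + analysis X y n) !analysis_coef//.
by rewrite ipDl ipZl.
Qed.

Lemma analysis_bounded X M : upper_frame_bound X M ->
  bounded_by (analysis X) (Num.sqrt M).
Proof.
move=> uX f; have [M0 /(_ f)] := uX.
rewrite nrm_analysis; last by exists M.
rewrite lee_fin => h.
rewrite -(@ler_pXn2r _ 2) ?nnegrE ?mulr_ge0 ?nrm_ge0 ?sqrtr_ge0//.
by rewrite exprMn sqr_sqrtr// ltW.
Qed.

Lemma analysis_bounded_op X : is_bessel X -> bounded_op (analysis X).
Proof.
move=> bX; have [M /analysis_bounded] := bX.
by apply: bounded_by_op; exact: analysis_linear.
Qed.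

Lemma analysis_lower X m : is_bessel X -> lower_frame_bound X m ->
  forall f, Num.sqrt m * nrm f <= nrm (analysis X f).
Proof.
move=> bX [m0 h] f; have := h f; rewrite nrm_analysis// lee_fin => {}h.
rewrite -(@ler_pXn2r _ 2) ?nnegrE ?mulr_ge0 ?nrm_ge0 ?sqrtr_ge0//.
by rewrite exprMn sqr_sqrtr// ltW.
Qed.

Lemma lower_of_analysis X c : is_bessel X -> 0 < c ->
  (forall f, c * nrm f <= nrm (analysis X f)) -> lower_frame_bound X (c ^+ 2).
Proof.
move=> bX c0 h; split; first exact: exprn_gt0.
move=> f; rewrite nrm_analysis// lee_fin -exprMn.
by apply: lerXn2r; rewrite ?nnegrE ?nrm_ge0// mulr_ge0 ?nrm_ge0 ?ltW.
Qed.

Lemma synthesisP X f (a : ell2 R F) : is_bessel X ->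
  ip (analysis X f) a = ip f (synthesis X a).
Proof. by move=> bX; apply: adjointP; exact: analysis_bounded_op. Qed.

Lemma synthesis_bounded_op X : is_bessel X -> bounded_op (synthesis X).
Proof. by move=> bX; apply: adjoint_bounded_op; exact: analysis_bounded_op. Qed.

Lemma coefB X Y f n : is_bessel X -> is_bessel Y ->
  (analysis X \- analysis Y) f n = ip f ((X \- Y) n).
Proof.
move=> bX bY; rewrite -[LHS]/(analysis X f n - analysis Y f n).
by rewrite !analysis_coef// -ipBr.
Qed.

Lemma is_besselB X Y : is_bessel X -> is_bessel Y -> is_bessel (X \- Y).
Proof.
move=> bX bY.
have [C C0 hC] := bounded_op_by (analysis_bounded_op bX).
have [D D0 hD] := bounded_op_by (analysis_bounded_op bY).
apply: (@bessel_of_bounded _ (analysis X \- analysis Y) (C + D)).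
  by move=> f n; exact: coefB.
move=> f; rewrite (le_trans (ler_nrmD _ _))// nrmN mulrDl.
by apply: lerD; [exact: hC | exact: hD].
Qed.

Lemma analysisB X Y : is_bessel X -> is_bessel Y ->
  analysis (X \- Y) = analysis X \- analysis Y.
Proof. by move=> bX bY; apply: analysis_eq => f n; exact: coefB. Qed.

Lemma synthesisB X Y : is_bessel X -> is_bessel Y ->
  synthesis (X \- Y) = synthesis X \- synthesis Y.
Proof.
move=> bX bY; apply/funext => a; apply: ip_inj => f /=.
rewrite -synthesisP; last exact: is_besselB.
by rewrite ipBr -!synthesisP// analysisB//= ipBl.
Qed.

Lemma synthesis_bounded X C : is_bessel X -> 0 <= C ->
  bounded_by (analysis X) C -> bounded_by (synthesis X) C.
Proof. by move=> bX; apply: adjoint_bounded; exact: analysis_bounded_op. Qed.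

(** An operator is bounded by the norm of its adjoint; with [fr_norm_le], the
    frame norm of [X] is the operator norm of its analysis operator. *)
Lemma analysis_opnorm X : is_bessel X ->
  bounded_by (analysis X) (fr_norm X).
Proof.
move=> bX f; have bT := synthesis_bounded_op bX.
have [->|y0] := eqVneq (nrm (analysis X f)) 0.
  by rewrite mulr_ge0 ?nrm_ge0 ?opnorm_ge0.
have yp : 0 < nrm (analysis X f) by rewrite lt_neqAle eq_sym y0 nrm_ge0.
rewrite -(ler_pM2l yp) -expr2 -re_ipxx synthesisP//.
rewrite (le_trans (re_ip_le _ _))// mulrC mulrCA mulrA ler_wpM2r ?nrm_ge0//.
exact: nrm_opnorm.
Qed.

Lemma fr_norm_le X C : is_bessel X -> 0 <= C ->
  bounded_by (analysis X) C -> fr_norm X <= C.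
Proof. by move=> bX C0 h; apply: opnorm_le => //; exact: synthesis_bounded. Qed.

End bessel.

(** * The frame operator and the approximate duals of a frame *)

Section frame_theory.
Variables (R : realType) (F : scalars) (H : hilbertType R F).
Variables (X : nat -> H) (c : R).
Hypotheses (bX : is_bessel X) (c0 : 0 < c).
Hypothesis lowX : forall f, c * nrm f <= nrm (analysis X f).

Local Notation U := (analysis X).
Local Notation T := (synthesis X).
Local Notation S := (frame_op X).
Local Notation Sinv := (op_inv S).

Lemma ip_frame_op f g : ip f (S g) = ip (U f) (U g).
Proof. by rewrite synthesisP. Qed.

Lemma frame_opB f g : S (f - g) = S f - S g.
Proof.
apply: ip_inj => h; rewrite [RHS]ipBr.
apply: (etrans (ip_frame_op h (f - g))).
rewrite (linear_funB _ _ (analysis_linear bX)) ipBr.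
by congr (_ - _); apply/esym/ip_frame_op.
Qed.

Lemma frame_op_inj : injective S.
Proof.
move=> f g fg; apply/eqP; rewrite -subr_eq0; apply/eqP/nrm_eq0/eqP.
have h := lowX (f - g); have h0 := nrm_ge0 (f - g).
have : nrm (U (f - g)) ^+ 2 = 0.
  by rewrite -re_ipxx -ip_frame_op frame_opB fg subrr ip0r re0.
move=> /eqP; rewrite expf_eq0 /= => /eqP Ufg; rewrite Ufg in h.
by rewrite eq_le h0 andbT; rewrite pmulr_rle0 in h.
Qed.

Lemma op_invK f : S (Sinv f) = f.
Proof.
have [C C0 bU] := bounded_op_by (analysis_bounded_op bX).
have [x xP] : exists x, forall u, ip (U u) (U x) = ip u f.
  apply: (@energy_minimizer _ _ _ _ U c C (nrm f)) => //.
  - exact: analysis_linear.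
  - exact: nrm_ge0.
  - by move=> a v w; rewrite ipDl ipZl.
  - by move=> z; rewrite mulrC; exact: nrm_ip_le.
have Sx : S x = f by apply: ip_inj => u; rewrite ip_frame_op xP.
rewrite /op_inv; case: xgetP => [z _ Sz|/(_ x) nSx]; first exact: Sz.
by case: (nSx Sx).
Qed.

Lemma frame_opK f : Sinv (S f) = f.
Proof. by apply: frame_op_inj; rewrite op_invK. Qed.

Lemma op_inv_selfadjoint f g : ip (Sinv f) g = ip f (Sinv g).
Proof.
rewrite -{1}(op_invK g) ip_frame_op ip_conj -ip_frame_op op_invK.
by rewrite -ip_conj.
Qed.

Lemma op_inv_linear : linear Sinv.
Proof.
move=> a f g; apply: ip_inj => h.
by rewrite ipDr ipZr -!op_inv_selfadjoint ipDr ipZr.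
Qed.

(** The operator [U S^-1]: the pseudo-inverse of the synthesis operator, and the
    analysis operator of the canonical dual. *)
Definition pinv_syn : H -> ell2 R F := U \o Sinv.
Local Notation L := pinv_syn.

Lemma ip_pinv_syn g a : ip (L g) a = ip (Sinv g) (T a).
Proof. exact: synthesisP. Qed.

Lemma synthesis_pinv g : T (L g) = g.
Proof. exact: op_invK. Qed.

Lemma pinv_syn_analysis f : L (T (U f)) = U f.
Proof. by rewrite /pinv_syn /= [Sinv _]frame_opK. Qed.

Lemma pinv_syn_linear : linear L.
Proof.
move=> a f g; rewrite /pinv_syn /= (linear_funE op_inv_linear).
exact: (linear_funE (analysis_linear bX)).
Qed.

Lemma pinv_syn_bounded : bounded_by L c^-1.
Proof.
move=> g; have [->|y0] := eqVneq (nrm (L g)) 0.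
  by rewrite mulr_ge0 ?nrm_ge0// invr_ge0 ltW.
have yp : 0 < nrm (L g) by rewrite lt_neqAle eq_sym y0 nrm_ge0.
(* |L g|^2 = Re <S^-1 g, g>, and c |S^-1 g| <= |L g|. *)
rewrite -(ler_pM2l yp) -expr2 -re_ipxx ip_pinv_syn synthesis_pinv.
rewrite (le_trans (re_ip_le _ _))// mulrA ler_wpM2r ?nrm_ge0//.
by rewrite -ler_pdivrMr ?invr_gt0// invrK mulrC; exact: lowX.
Qed.

Lemma op_inv_bounded : bounded_by Sinv (c^-1 ^+ 2).
Proof.
move=> g; have := pinv_syn_bounded g; have := lowX (Sinv g).
rewrite -[U (Sinv g)]/(L g) => h1 h2; have := le_trans h1 h2.
by rewrite -ler_pdivlMl// mulrA -expr2.
Qed.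

(** The orthogonal projection onto the kernel of the synthesis operator (see
    [orthoproj_ker]), by an explicit formula. *)
Definition kerproj (a : ell2 R F) : ell2 R F := a - L (T a).

Lemma synthesis_linear : linear T.
Proof. by case: (synthesis_bounded_op bX). Qed.

Lemma kerproj_ker a : T (kerproj a) = 0.
Proof.
by rewrite /kerproj (linear_funB _ _ synthesis_linear) synthesis_pinv subrr.
Qed.

Lemma kerproj_analysis f : kerproj (U f) = 0.
Proof. by rewrite /kerproj pinv_syn_analysis subrr. Qed.

Lemma kerprojB a b : kerproj (a - b) = kerproj a - kerproj b.
Proof.
rewrite /kerproj (linear_funB _ _ synthesis_linear).
rewrite (linear_funB _ _ pinv_syn_linear) !opprB.
by rewrite [X in a - b + X]addrC addrACA [in LHS](addrC (- b)).
Qed.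

Lemma pinv_ker_orth g a : T a = 0 -> ip (L g) a = 0.
Proof. by move=> h; rewrite ip_pinv_syn h ip0r. Qed.

Lemma pythagoras g a : T a = 0 -> nrm (L g + a) ^+ 2 = nrm (L g) ^+ 2 + nrm a ^+ 2.
Proof. by move=> h; rewrite nrmD_sqr pinv_ker_orth// re0 mulr0 addr0. Qed.

Lemma kerproj_le a : nrm (kerproj a) <= nrm a.
Proof.
have h := pythagoras (T a) (kerproj_ker a).
rewrite /kerproj addrC subrK -/(kerproj a) in h.
by rewrite -(@ler_pXn2r _ 2) ?nnegrE ?nrm_ge0// h lerDr sqr_ge0.
Qed.

Lemma orthoproj_ker a : orthoproj (op_ker T) a = kerproj a.
Proof.
have P0 : op_ker T (kerproj a) /\
    forall z, op_ker T z -> ip (a - kerproj a) z = 0.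
  split; first exact: kerproj_ker.
  by move=> z Tz; rewrite /kerproj subKr pinv_ker_orth.
rewrite /orthoproj; case: xgetP => [p _ [Tp pP]|/(_ _ P0)//].
(* Two candidates differ by an element of the kernel orthogonal to the kernel. *)
have kpp : op_ker T (p - kerproj a).
  by rewrite /op_ker /= (linear_funB _ _ synthesis_linear) Tp kerproj_ker subrr.
apply/eqP; rewrite -subr_eq0; apply/eqP/nrm_eq0/eqP.
rewrite -[_ == 0](@expf_eq0 _ _ 2) -re_ipxx.
have [_ h] := P0; have := h _ kpp; have := pP _ kpp => h1 h2.
have {1}-> : p - kerproj a = (a - kerproj a) - (a - p).
  by rewrite (opprB a p) [RHS]addrC subrKA.
by rewrite ipBl h1 h2 subrr re0.
Qed.

Section approximate_duals.
Variables (A : H -> H) (Theta : H -> ell2 R F).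
Hypotheses (bA : bounded_op A) (bTheta : bounded_op Theta).

Let W f := L (A f) + Theta f.

(** Since [S^-1] is self-adjoint, the coordinates of [L A + Theta] are the
    coefficients with respect to the approximate dual. *)
Lemma ad_coef f n : W f n = ip f (ad X Theta A n).
Proof.
rewrite /ad ipDr -!adjointP// ip_delta -op_inv_selfadjoint.
by rewrite -(analysis_coef _ _ bX).
Qed.

Lemma analysis_ad : analysis (ad X Theta A) = fun f => L (A f) + Theta f.
Proof. exact: analysis_eq ad_coef. Qed.

Lemma ad_bessel : is_bessel (ad X Theta A).
Proof.
apply: (bessel_of_bounded ad_coef (C := c^-1 * opnorm A + opnorm Theta)) => f.
rewrite (le_trans (ler_nrmD _ _))// mulrDl.
apply: lerD; last exact: (nrm_opnorm bTheta).
rewrite (le_trans (pinv_syn_bounded _))// -mulrA ler_wpM2l ?invr_ge0 ?(ltW c0)//.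
exact: (nrm_opnorm bA).
Qed.

(** The mixed operator [T_X U_(X^ad)] of an approximate dual is [A]. *)
Lemma synthesis_ad f : T (Theta f) = 0 -> T (analysis (ad X Theta A) f) = A f.
Proof.
move=> h; rewrite analysis_ad (linear_funD _ _ synthesis_linear) h addr0.
exact: synthesis_pinv.
Qed.

End approximate_duals.

End frame_theory.

(** * Best approximation by approximate duals *)

Section bounded_op_algebra.
Variables (R : realType) (F : scalars) (U V : hilbertType R F).

Lemma bounded_op0 : bounded_op (fun _ : U => 0 : V).
Proof.
apply: (@bounded_by_op _ _ _ _ _ 0).
  by move=> a x y; rewrite [RHS]addr0 scaler0.
by move=> x; rewrite nrm0 mul0r.
Qed.

Lemma bounded_opB (A B : U -> V) : bounded_op A -> bounded_op B ->
  bounded_op (A \- B).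
Proof.
move=> bA bB; have [linA _] := bA; have [linB _] := bB.
apply: (@bounded_by_op _ _ _ _ _ (opnorm A + opnorm B)).
  move=> a x y; rewrite /= (linear_funE linA) (linear_funE linB).
  by rewrite opprD addrACA -scalerBr.
move=> x; rewrite (le_trans (ler_nrmD _ _))// nrmN mulrDl.
by apply: lerD; [exact: (nrm_opnorm bA) | exact: (nrm_opnorm bB)].
Qed.

Lemma bounded_op_id : bounded_op (idfun : U -> U).
Proof. by apply: (@bounded_by_op _ _ _ _ _ 1) => // x; rewrite mul1r. Qed.

End bounded_op_algebra.

Section best.
Variables (R : realType) (F : scalars) (H : hilbertType R F).
Variables (Y Z : nat -> H) (d : R) (A : H -> H).
Hypotheses (bY : is_bessel Y) (bZ : is_bessel Z) (d0 : 0 < d).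
Hypothesis lowY : forall f, d * nrm f <= nrm (analysis Y f).
Hypothesis bA : bounded_op A.

Local Notation T := (synthesis Y).
Local Notation L := (pinv_syn Y).
Local Notation V := (analysis Z).

(** The operator [P U_Z], with [P] the projection onto [ker T_Y]; the approximate
    dual of [Y] that it gives is the closest to [Z] (see [ba_best]). *)
Definition ba_op : H -> ell2 R F := orthoproj (op_ker T) \o V.

Lemma ba_opE f : ba_op f = kerproj Y (V f).
Proof. exact: (orthoproj_ker bY d0 lowY). Qed.

Lemma ba_op_ran : ran_syn Y ba_op.
Proof.
split; last by move=> f; rewrite ba_opE; exact: (kerproj_ker bY d0 lowY).
apply: (@bounded_by_op _ _ _ _ _ (opnorm V)).
  move=> a f g; rewrite !ba_opE /kerproj.
  rewrite (linear_funE (analysis_linear bZ)) (linear_funE (synthesis_linear bY)).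
  rewrite (linear_funE (pinv_syn_linear bY d0 lowY)).
  by rewrite opprD addrACA -scalerBr.
move=> f; rewrite ba_opE (le_trans (kerproj_le bY d0 lowY _))//.
exact: (nrm_opnorm (analysis_bounded_op bZ)).
Qed.

(** The first summand lies in the range of [L], the second one in [ker T] when
    [Theta] does; the choice [Theta = ba_op] cancels the second one. *)
Lemma analysis_adB Theta f : bounded_op Theta ->
  analysis (ad Y Theta A \- Z) f = L (A f - T (V f)) + (Theta f - ba_op f).
Proof.
move=> bT; rewrite (analysisB (ad_bessel bY d0 lowY bA bT) bZ) /=.
rewrite (analysis_ad bY d0 lowY bA bT) ba_opE /kerproj.
rewrite (linear_funB _ _ (pinv_syn_linear bY d0 lowY)).
by rewrite (opprB (V f)) [RHS]addrCA subrKA [RHS]addrCA [RHS]addrA.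
Qed.

Lemma analysis_ad_ba f :
  analysis (ad Y ba_op A \- Z) f = L (A f - T (V f)).
Proof. by case: ba_op_ran => bT _; rewrite analysis_adB// subrr addr0. Qed.

Lemma ba_best : best_approximation Y A ba_op Z.
Proof.
move=> Theta [bT kT]; have [bba kba] := ba_op_ran.
have bW := is_besselB (ad_bessel bY d0 lowY bA bT) bZ.
apply: fr_norm_le.
- exact: (is_besselB (ad_bessel bY d0 lowY bA bba) bZ).
- exact: opnorm_ge0 (synthesis_bounded_op bW).
- move=> f; apply: le_trans (analysis_opnorm bW f).
  rewrite analysis_ad_ba analysis_adB//.
  have kTba : T (Theta f - ba_op f) = 0.
    by rewrite (linear_funB _ _ (synthesis_linear bY)) kT kba subrr.
  rewrite -(@ler_pXn2r _ 2) ?nnegrE ?nrm_ge0//.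
  by rewrite (pythagoras bY (A f - T (V f)) kTba) lerDl sqr_ge0.
Qed.

End best.

(** * Distances between approximate duals of two close frames *)

Section two_frames.
Variables (R : realType) (F : scalars) (H : hilbertType R F).
Variables (X Y : nat -> H) (c d s : R).
Hypotheses (bX : is_bessel X) (bY : is_bessel Y).
Hypotheses (c0 : 0 < c) (d0 : 0 < d) (s0 : 0 <= s).
Hypothesis lowX : forall f, c * nrm f <= nrm (analysis X f).
Hypothesis lowY : forall f, d * nrm f <= nrm (analysis Y f).
Hypothesis closeXY : bounded_by (analysis (X \- Y)) s.
Variables (A1 A2 : H -> H).
Hypotheses (bA1 : bounded_op A1) (bA2 : bounded_op A2).

Let bXY := is_besselB bX bY.

Let closeT : bounded_by (synthesis (X \- Y)) s.
Proof. exact: synthesis_bounded. Qed.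

(** Distance from an approximate dual of [X] to its best approximation. *)
Lemma ba_fr_norm Theta : ran_syn X Theta ->
  fr_norm (ad Y (ba_op Y (ad X Theta A1)) A2 \- ad X Theta A1) <=
  d^-1 * (opnorm (A1 \- A2) + s * (c^-1 * opnorm A1 + opnorm Theta)).
Proof.
move=> [bT kT]; have bZ := ad_bessel bX c0 lowX bA1 bT.
have [bba _] := ba_op_ran bY bZ d0 lowY.
have di : 0 <= d^-1 by rewrite invr_ge0 ltW.
have ci : 0 <= c^-1 by rewrite invr_ge0 ltW.
have o1 := opnorm_ge0 bA1; have o12 := opnorm_ge0 (bounded_opB bA1 bA2).
have oT := opnorm_ge0 bT.
apply: fr_norm_le.
- exact: (is_besselB (ad_bessel bY d0 lowY bA2 bba) bZ).
- by rewrite mulr_ge0 ?addr_ge0 ?mulr_ge0 ?addr_ge0 ?mulr_ge0.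
move=> f; rewrite (analysis_ad_ba bY bZ d0 lowY bA2).
set V := analysis _ f.
rewrite (le_trans (pinv_syn_bounded bY d0 lowY _))// -mulrA ler_wpM2l//.
(* T_X V = A1 f, so that A1 f - T_Y V = (T_X - T_Y) V. *)
have -> : A2 f - synthesis Y V = - (A1 f - A2 f) + synthesis (X \- Y) V.
  rewrite (synthesisB bX bY) /= /V (synthesis_ad bX c0 lowX bA1 bT (kT f)).
  by rewrite opprB subrKA.
rewrite (le_trans (ler_nrmD _ _))// nrmN mulrDl; apply: lerD.
  exact: (nrm_opnorm (bounded_opB bA1 bA2)).
rewrite (le_trans (closeT _))// -mulrA ler_wpM2l// /V.
rewrite (analysis_ad bX c0 lowX bA1 bT) (le_trans (ler_nrmD _ _))// mulrDl.
apply: lerD; last exact: (nrm_opnorm bT).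
rewrite (le_trans (pinv_syn_bounded bX c0 lowX _))// -mulrA ler_wpM2l//.
exact: (nrm_opnorm bA1).
Qed.

(** Perturbation of the pseudo-inverse: the difference is split along the range
    of [U_Y] and the kernel of [T_Y]. *)
Lemma pinv_syn_dist g :
  nrm (pinv_syn X g - pinv_syn Y g) <= (d^-1 * (s * c^-1) + s * c^-1 ^+ 2) * nrm g.
Proof.
have di : 0 <= d^-1 by rewrite invr_ge0 ltW.
set a := pinv_syn X g.
have -> : a - pinv_syn Y g =
    pinv_syn Y (- synthesis (X \- Y) a) +
    kerproj Y (analysis (X \- Y) (op_inv (frame_op X) g)).
  rewrite (synthesisB bX bY) (analysisB bX bY) /=.
  rewrite (kerprojB bY d0 lowY) (kerproj_analysis bY d0 lowY) subr0.
  rewrite -[analysis X _]/a /kerproj (synthesis_pinv bX c0 lowX) opprB.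
  rewrite (linear_funB _ _ (pinv_syn_linear bY d0 lowY)).
  by rewrite [RHS]addrC subrKA.
rewrite (le_trans (ler_nrmD _ _))// mulrDl; apply: lerD.
  rewrite (le_trans (pinv_syn_bounded bY d0 lowY _))// nrmN -!mulrA ler_wpM2l//.
  rewrite (le_trans (closeT _))// ler_wpM2l//.
  exact: (pinv_syn_bounded bX c0 lowX).
rewrite (le_trans (kerproj_le bY d0 lowY _))// (le_trans (closeXY _))//.
by rewrite -mulrA ler_wpM2l// (op_inv_bounded bX c0 lowX).
Qed.

(** Distance between the canonical approximate duals ([Theta = 0]). *)
Lemma canonical_fr_norm :
  fr_norm (ad X (fun=> 0) A1 \- ad Y (fun=> 0) A2) <=
  d^-1 * opnorm (A1 \- A2) + (d^-1 * (s * c^-1) + s * c^-1 ^+ 2) * opnorm A1.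
Proof.
have b0 : bounded_op (fun _ : H => 0 : ell2 R F) by exact: bounded_op0.
have di : 0 <= d^-1 by rewrite invr_ge0 ltW.
have ci : 0 <= c^-1 by rewrite invr_ge0 ltW.
have o1 := opnorm_ge0 bA1; have o12 := opnorm_ge0 (bounded_opB bA1 bA2).
have b1 := ad_bessel bX c0 lowX bA1 b0.
have b2 := ad_bessel bY d0 lowY bA2 b0.
have k0 : 0 <= d^-1 * (s * c^-1) + s * c^-1 ^+ 2.
  by rewrite addr_ge0 ?mulr_ge0 ?sqr_ge0.
apply: fr_norm_le.
- exact: is_besselB.
- by rewrite addr_ge0 ?mulr_ge0.
move=> f; rewrite (analysisB b1 b2) /=.
rewrite (analysis_ad bX c0 lowX bA1 b0) (analysis_ad bY d0 lowY bA2 b0) !addr0.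
have -> : pinv_syn X (A1 f) - pinv_syn Y (A2 f) = pinv_syn Y (A1 f - A2 f) +
    (pinv_syn X (A1 f) - pinv_syn Y (A1 f)).
  rewrite (linear_funB _ _ (pinv_syn_linear bY d0 lowY)).
  by rewrite [RHS]addrC subrKA.
rewrite (le_trans (ler_nrmD _ _))// mulrDl; apply: lerD.
  rewrite (le_trans (pinv_syn_bounded bY d0 lowY _))// -mulrA ler_wpM2l//.
  exact: (nrm_opnorm (bounded_opB bA1 bA2)).
rewrite (le_trans (pinv_syn_dist _))// -mulrA ler_wpM2l//.
exact: (nrm_opnorm bA1).
Qed.

End two_frames.

(** * Consequences of quadratic closeness *)

Section quadratic_closeness.
Variables (R : realType) (F : scalars) (H : hilbertType R F).

Lemma ell2_nrm_ip_le (x y : ell2 R F) (B : R) :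
  (forall n, \sum_(0 <= i < n) nrm (x i) * nrm (y i) <= B) -> nrm (ip x y) <= B.
Proof.
move=> h; have xy : nrm (series (fun n => x n * conj (y n)) n) @[n --> \oo] -->
    nrm (ip x y) by apply: cvg_nrm; exact: ell2_ip_cvg.
rewrite -(cvg_lim _ xy)//; apply: limr_le; first exact: cvgP xy.
apply: nearW => n; apply: le_trans (h n).
rewrite /series /=; elim: n {h} => [|n IH]; first by rewrite !big_geq// nrm0.
rewrite !big_nat_recr//= (le_trans (ler_nrmD _ _))// lerD//.
by rewrite nrmM nrm_conj.
Qed.

Lemma partial_sum_le (u : nat -> R) n : (forall i, 0 <= u i) ->
  (\sum_(0 <= i <oo) (u i)%:E < +oo)%E ->
  \sum_(0 <= i < n) u i <= fine (\sum_(0 <= i <oo) (u i)%:E)%E.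
Proof.
move=> u0 uoo; rewrite -lee_fin fineK; last first.
  by rewrite ge0_fin_numE// nneseries_ge0// => i _ _; rewrite lee_fin.
by rewrite -sumEFin; apply: nneseries_lim_ge => i _; rewrite lee_fin.
Qed.

Lemma upper_of_sqr_summable (D : nat -> H) (q : R) : 0 < q ->
  (forall n, \sum_(0 <= i < n) nrm (D i) ^+ 2 <= q) -> upper_frame_bound D q.
Proof.
move=> q0 h; split => // f; apply: lime_le.
  by apply: is_cvg_nneseries => n _ _; rewrite lee_fin sqr_ge0.
apply: nearW => n; rewrite sumEFin lee_fin.
apply: (@le_trans _ _ (\sum_(0 <= i < n) nrm (D i) ^+ 2 * nrm f ^+ 2)).
  apply: ler_sum => i _; rewrite -exprMn [nrm (D i) * _]mulrC.
  by apply: lerXn2r; rewrite ?nnegrE ?mulr_ge0 ?nrm_ge0//; exact: nrm_ip_le.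
by rewrite -mulr_suml ler_wpM2r ?sqr_ge0.
Qed.

(** A dual [E] of [X] turns closeness of [Y] to [X] into a lower frame inequality
    for [Y], since [|f|^2 = <(U_X - U_Y) f, U_E f> + <U_Y f, U_E f>]. *)
Lemma lower_of_dual_close (X Y E : nat -> H) (p M : R) :
  is_bessel X -> is_bessel Y -> upper_frame_bound E M ->
  (forall f, ip (analysis X f) (analysis E f) = ip f f) ->
  (forall n, \sum_(0 <= i < n) nrm (X i - Y i) * nrm (E i) <= p) ->
  p < 1 ->
  forall f, (1 - p) / Num.sqrt M * nrm f <= nrm (analysis Y f).
Proof.
move=> bX bY uE dual hp p1 f; have bE : is_bessel E by exists M.
have M0 : 0 < Num.sqrt M by rewrite sqrtr_gt0; case: uE.
have bXY := is_besselB bX bY.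
have [->|f0] := eqVneq (nrm f) 0; first by rewrite mulr0 nrm_ge0.
have fp : 0 < nrm f by rewrite lt_neqAle eq_sym f0 nrm_ge0.
have h1 : re (ip (analysis (X \- Y) f) (analysis E f)) <= p * nrm f ^+ 2.
  have := le_trans (ler_norm _) (re_le_nrm
    (ip (analysis (X \- Y) f) (analysis E f))); move/le_trans; apply.
  apply: ell2_nrm_ip_le => n.
  apply: (@le_trans _ _ (\sum_(0 <= i < n)
      nrm (X i - Y i) * nrm (E i) * nrm f ^+ 2)); last first.
    by rewrite -mulr_suml ler_wpM2r ?sqr_ge0.
  apply: ler_sum => i _; rewrite !analysis_coef//.
  rewrite expr2 mulrACA; apply: ler_pM; rewrite ?nrm_ge0// mulrC;
    exact: nrm_ip_le.
have h2 : re (ip (analysis Y f) (analysis E f)) <=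
    nrm (analysis Y f) * (Num.sqrt M * nrm f).
  rewrite (le_trans (re_ip_le _ _))// ler_wpM2l ?nrm_ge0//.
  exact: analysis_bounded.
have h3 : nrm f ^+ 2 = re (ip (analysis (X \- Y) f) (analysis E f)) +
    re (ip (analysis Y f) (analysis E f)).
  rewrite -reD -ipDl analysisB//= subrK dual.
  by rewrite re_ipxx.
rewrite mulrAC ler_pdivrMr// -(ler_pM2r fp); lra.
Qed.

End quadratic_closeness.

Theorem theorem4p8 (R : realType) (F : scalars) (H : hilbertType R F)
    (separableH : exists D : set H, countable D /\ dense D)
    (Phi Psi : nat -> H) (m : R)
    (framePhi : is_frame Phi) (lowerPhi : lower_frame_bound Phi m)
    (A1 A2 : H -> H)
    (boundedA1 : bounded_op A1) (closeA1 : opnorm (idfun \- A1) < 1)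
    (boundedA2 : bounded_op A2) (closeA2 : opnorm (idfun \- A2) < 1)
    (Lambda : H -> ell2 R F) (ranLambda : ran_syn Phi Lambda)
    (M : R) (upperM : upper_frame_bound (dual_frame Phi Lambda) M)
    (dclose : d_quadratically_close Phi m Psi Lambda)
    (dqdist_lt1 : (dqdist Phi Psi Lambda < 1%:E)%E) :
  let q := fine (qdist Phi Psi) in
  let qL := fine (dqdist Phi Psi Lambda) in
  [/\ is_frame Psi,
      forall Theta : H -> ell2 R F, ran_syn Phi Theta ->
        let Theta_ba :=
          orthoproj (op_ker (synthesis Psi)) \o analysis (ad Phi Theta A1) in
        let rho := Num.sqrt (q * M) / (1 - qL) *
          (opnorm A1 / Num.sqrt m + opnorm Theta
           + opnorm (A1 \- A2) / Num.sqrt q) in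
        [/\ ran_syn Psi Theta_ba,
            AD Psi (ad Psi Theta_ba A2),
            best_approximation Psi A2 Theta_ba (ad Phi Theta A1)
          & perturbation rho (ad Psi Theta_ba A2) (ad Phi Theta A1)],
      Num.sqrt (m * M) <= 1 - qL ->
        fr_norm (ad Phi (fun=> 0) A1 \- ad Psi (fun=> 0) A2) <=
          (2 * Num.sqrt q * opnorm A1 + Num.sqrt m * opnorm (A1 \- A2)) / m
    & 1 - qL < Num.sqrt (m * M) ->
        fr_norm (ad Phi (fun=> 0) A1 \- ad Psi (fun=> 0) A2) <=
          Num.sqrt M / (1 - qL) *
            (2 * opnorm A1 * Num.sqrt (q / m) + opnorm (A1 \- A2))].
Proof.
move=> q qL.
have bPhi : is_bessel Phi by case: framePhi => ? [N [_ uN]]; exists N.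
have [m0 _] := lowerPhi; have [M0 _] := upperM.
have [qoo mq dqoo] := dclose.
have sm0 : 0 < Num.sqrt m by rewrite sqrtr_gt0.
have sM0 : 0 < Num.sqrt M by rewrite sqrtr_gt0.
have qE : qdist Phi Psi = q%:E.
  rewrite fineK// ge0_fin_numE// nneseries_ge0// => i _ _.
  by rewrite lee_fin sqr_ge0.
have qLE : dqdist Phi Psi Lambda = qL%:E.
  rewrite fineK// ge0_fin_numE// nneseries_ge0// => i _ _.
  by rewrite lee_fin mulr_ge0 ?nrm_ge0.
have q0 : 0 < q by rewrite (lt_le_trans m0)// -lee_fin -qE.
have qL1 : qL < 1 by rewrite -lte_fin -qLE.
have sq0 : 0 < Num.sqrt q by rewrite sqrtr_gt0.
have p0 : 0 < 1 - qL by rewrite subr_gt0.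
have low1 := analysis_lower bPhi lowerPhi.
(* By Cauchy-Schwarz in each coefficient, Phi - Psi is Bessel with bound q, and
   therefore Psi is Bessel. *)
have uD : upper_frame_bound (Phi \- Psi) q.
  apply: upper_of_sqr_summable => // n.
  exact: (partial_sum_le n (fun i => sqr_ge0 _) qoo).
have bD : is_bessel (Phi \- Psi) by exists q.
have bPsi : is_bessel Psi.
  have -> : Psi = Phi \- (Phi \- Psi) by apply/funext => n /=; rewrite subKr.
  exact: is_besselB.
have closeD := analysis_bounded uD.
have [bL kL] := ranLambda.
have dual f : ip (analysis Phi f) (analysis (dual_frame Phi Lambda) f) = ip f f.
  have bid := bounded_op_id H.
  by rewrite synthesisP// (synthesis_ad bPhi sm0 low1 bid bL (kL f)).
have pos i : 0 <= nrm (Phi i - Psi i) * nrm (dual_frame Phi Lambda i).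
  by rewrite mulr_ge0 ?nrm_ge0.
(* Psi has lower frame bound ((1 - qL) / sqrt M)^2. *)
have low2 := lower_of_dual_close bPhi bPsi upperM dual
  (fun n => partial_sum_le n pos dqoo) qL1.
rewrite -[fine _]/qL in low2.
have d0 : 0 < (1 - qL) / Num.sqrt M by rewrite divr_gt0.
have di : ((1 - qL) / Num.sqrt M)^-1 = Num.sqrt M / (1 - qL) by rewrite invf_div.
have o1 := opnorm_ge0 boundedA1.
have o12 := opnorm_ge0 (bounded_opB boundedA1 boundedA2).
have sqm : Num.sqrt m ^+ 2 = m by rewrite sqr_sqrtr// ltW.
have can := canonical_fr_norm bPhi bPsi sm0 d0 (ltW sq0) low1 low2 closeD
  boundedA1 boundedA2.
rewrite di in can; split.
- have [N uN] := bPsi; exists (((1 - qL) / Num.sqrt M) ^+ 2), N.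
  by split => //; exact: lower_of_analysis.
- move=> Theta ranT Theta_ba rho; have [bT kT] := ranT.
  have bZ := ad_bessel bPhi sm0 low1 boundedA1 bT.
  have ranba : ran_syn Psi Theta_ba := ba_op_ran bPsi bZ d0 low2.
  have [bba kba] := ranba.
  have bW := ad_bessel bPsi d0 low2 boundedA2 bba.
  split.
  + exact: ranba.
  + split; first exact: bW.
    have -> : synthesis Psi \o analysis (ad Psi Theta_ba A2) = A2.
      apply/funext => f; exact: (synthesis_ad bPsi d0 low2 boundedA2 bba (kba f)).
    exact: closeA2.
  + exact: ba_best bPsi bZ d0 low2 boundedA2.
  + split => //; rewrite -synthesisB//.
    have := ba_fr_norm bPhi bPsi sm0 d0 (ltW sq0) low1 low2 closeD
      boundedA1 boundedA2 ranT.
    rewrite di => /le_trans; apply; rewrite le_eqVlt; apply/orP; left; apply/eqP.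
    rewrite /rho sqrtrM ?(ltW q0)//.
    field; rewrite !gt_eqF//.
- move=> hM; apply: (le_trans can).
  have hc : Num.sqrt M / (1 - qL) <= (Num.sqrt m)^-1.
    rewrite ler_pdivrMr// ler_pdivlMl//.
    by rewrite -sqrtrM ?(ltW m0).
  have e1 : Num.sqrt M / (1 - qL) * opnorm (A1 \- A2) <=
    (Num.sqrt m)^-1 * opnorm (A1 \- A2) by rewrite ler_wpM2r.
  have e2 : Num.sqrt M / (1 - qL) * (Num.sqrt q / Num.sqrt m) * opnorm A1 <=
    (Num.sqrt m)^-1 * (Num.sqrt q / Num.sqrt m) * opnorm A1.
    by rewrite ler_wpM2r// ler_wpM2r// divr_ge0// ltW.
  apply: (le_trans (lerD e1 _)).
    rewrite mulrDl; exact: (lerD e2 (lexx _)).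
  rewrite le_eqVlt; apply/orP; left; apply/eqP.
  have -> : m^-1 = (Num.sqrt m)^-1 ^+ 2 by rewrite exprVn sqm.
  by field; rewrite gt_eqF.
- move=> hM; apply: (le_trans can).
  have hc : (Num.sqrt m)^-1 <= Num.sqrt M / (1 - qL).
    rewrite ler_pdivlMr// ler_pdivrMl//.
    by rewrite -sqrtrM ?(ltW m0)// ltW.
  have e2 : Num.sqrt q * (Num.sqrt m)^-1 ^+ 2 * opnorm A1 <=
     Num.sqrt M / (1 - qL) * (Num.sqrt q / Num.sqrt m) * opnorm A1.
    apply: ler_wpM2r => //; rewrite expr2 mulrCA; apply: ler_wpM2r => //.
  rewrite mulrDl; apply: (le_trans (lerD (lexx _) (lerD (lexx _) e2))).
  rewrite le_eqVlt; apply/orP; left; apply/eqP.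
  rewrite sqrtrM ?(ltW q0)// sqrtrV ?(ltW m0)//.
  by field; rewrite !gt_eqF.
Qed.
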